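(* Let $d\ge1$ and $0<\alpha<d$. The Riesz potential and the fractional maximal operator on $\mathbb R^d$, $$I_\alpha f(x)=\int_{\mathbb R^d}\frac{|f(y)|}{|x-y|^{d-\alpha}}\,dy,\qquad\mathcal M_\alpha f(x)=\sup_{B\ni x}\frac1{|B|^{1-\alpha/d}}\int_B|f(y)|\,dy$$ (the supremum over Euclidean balls $B$ containing $x$), are bounded oscillation operators on $L^1(\mathbb R^d)$, with respect to Lebesgue measure and the ball-basis of Euclidean balls, with parameters $$\varrho=r=1,\qquad\rho=1-\alpha/d.$$
   Context: Let $\mathscr B$ be the family of all Euclidean balls in $\mathbb R^d$, $|\cdot|$ Lebesgue measure, and for a ball $B$ let $B^*=\bigcup\{A\in\mathscr B:|A|\le2|B|,\ A\cap B\ne\varnothing\}$. With parameters $r=\varrho=1$, $\rho=1-\alpha/d$: $\langle f\rangle_B=|B|^{-\rho}\int_B|f|$, $\langle f\rangle_B^*=\sup_{A\in\mathscr B:A\supset B}\langle f\rangle_A$, $\mathrm{OSC}_B(g)=\operatorname{esssup}_{x,x'\in B}|g(x)-g(x')|$, $\mathrm{SUP}_B(g)=\operatorname{esssup}_{x\in B}|g(x)|$. A sublinear operator $T$ from $L^1(\mathbb R^d)$ to measurable functions (i.e. $|T(f+g)|\le|Tf|+|Tg|$) is a bounded oscillation operator with these parameters if there are constants $\mathcal L_0,\mathcal L_1,\mathcal L_2$ such that for all $f\in L^1(\mathbb R^d)$: (T0) for every ball $B$ and $\lambda>0$, $|\{x\in B:|T(f\mathbf 1_B)(x)|>\lambda\langle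 f\rangle_B\}|\le(\mathcal L_0/\lambda)^{1/\rho}|B|$; (T1) for every ball $B$, $\mathrm{OSC}_B(T(f\mathbf 1_{\mathbb R^d\setminus B^*}))\le\mathcal L_1\langle f\rangle_B^*$; (T2) for every ball $A$ there is a ball $B\supsetneq A$ (independent of $f$) with $\mathrm{SUP}_A(T(f\mathbf 1_{B^*\setminus A^*}))\le\mathcal L_2\langle f\rangle_{B^*}$. *)

(* Defs.v *)
From HB Require Import structures.
From mathcomp Require Import all_boot all_order all_algebra.
From mathcomp Require Import all_classical all_reals all_analysis.
From mathcomp Require Import measurable_realfun ess_sup_inf.

Set Implicit Arguments.
Unset Strict Implicit.
Unset Printing Implicit Defensive.

Import Order.TTheory GRing.Theory Num.Theory.
Import numFieldNormedType.Exports.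

Local Open Scope classical_set_scope.
Local Open Scope ring_scope.
Local Open Scope ereal_scope.

(* R^d, with the product sigma-algebra of d.-tuple, i.e. the Borel sets. Tuples
   rather than row vectors, because the latter carry no sigma-algebra and are
   normed by the sup norm. *)
Notation Rn R d := (d.-tuple (measurableTypeR R)).

Section lebesgue_measure_Rn.
Context {R : realType}.

Definition tcons n (p : measurableTypeR R * Rn R n) : Rn R n.+1 :=
  [tuple of p.1 :: p.2].

Lemma measurable_tcons n : measurable_fun [set: _] (@tcons n).
Proof. exact: measurable_cons. Qed.

Section step.
Context {n : nat} (m : {sigma_finite_measure set (Rn R n) -> \bar R}).

Definition lebesgue_step : set (Rn R n.+1) -> \bar R :=
  pushforward (@lebesgue_measure R \x m) (@tcons n).

Let step0 : lebesgue_step set0 = 0.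
Proof. by rewrite /lebesgue_step /pushforward preimage_set0 measure0. Qed.

Let step_ge0 A : 0 <= lebesgue_step A.
Proof. by rewrite /lebesgue_step /pushforward. Qed.

Let step_sigma_additive : semi_sigma_additive lebesgue_step.
Proof.
move=> F mF tF mUF; rewrite /lebesgue_step /pushforward preimage_bigcup.
apply: measure_semi_sigma_additive.
- by move=> k; rewrite -[X in measurable X]setTI; exact: measurable_tcons.
- apply/trivIsetP => /= i j _ _ ij; rewrite -preimage_setI.
  by move/trivIsetP : tF => /(_ _ _ _ _ ij) ->//; rewrite preimage_set0.
- rewrite -preimage_bigcup -[X in measurable X]setTI.
  exact: measurable_tcons.
Qed.

HB.instance Definition _ := isMeasure.Build _ _ _
  lebesgue_step step0 step_ge0 step_sigma_additive.

Let step_sigma_finite : sigma_finite setT lebesgue_step.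
Proof.
pose u (x : Rn R n.+1) : measurableTypeR R * Rn R n :=
  (thead x, [tuple of behead x]).
have uK : cancel (@tcons n) u.
  by move=> [a x]; rewrite /u theadE; congr pair; apply: val_inj.
have mu : measurable_fun setT u.
  apply: measurable_fun_pair; first exact: measurable_tnth.
  exact: measurable_behead.
have /sigma_finiteP[F [TF ndF Foo]] := sigma_finiteT (@lebesgue_measure R).
have /sigma_finiteP[G [TG ndG Goo]] := sigma_finiteT m.
exists (fun k => u @^-1` (F k `*` G k)).
  apply/seteqP; split=> // x _.
  have [k _ Fk] : (\bigcup_k F k) (u x).1 by rewrite -TF.
  have [l _ Gl] : (\bigcup_l G l) (u x).2 by rewrite -TG.
  exists (maxn k l) => //; split => /=.
  - by move: Fk; exact/subsetPset/ndF/leq_maxl.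
  - by move: Gl; exact/subsetPset/ndG/leq_maxr.
move=> k; have [mFk Fk] := Foo k; have [mGk Gk] := Goo k; split.
  by rewrite -[X in measurable X]setTI; apply: mu => //; exact: measurableX.
rewrite /lebesgue_step /pushforward (_ : _ @^-1` _ = F k `*` G k).
  by rewrite product_measure1E// lte_mul_pinfty// ge0_fin_numE.
by rewrite -[RHS]preimage_id -(_ : u \o @tcons n = id)//; apply/funext.
Qed.

HB.instance Definition _ :=
  Measure_isSigmaFinite.Build _ _ _ lebesgue_step step_sigma_finite.

End step.

(* Lebesgue measure on R^n as an n-fold product; lebesgue_box evaluates it. *)
Fixpoint lebesgue n : {sigma_finite_measure set (Rn R n) -> \bar R} :=
  match n return {sigma_finite_measure set (Rn R n) -> \bar R} with
  | 0%N => \d_([tuple] : Rn R 0)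
  | k.+1 => lebesgue_step (lebesgue k)
  end.

Lemma lebesgue_box n (A : 'I_n -> set (measurableTypeR R)) :
  (forall i, measurable (A i)) ->
  lebesgue n [set x | forall i, A i (tnth x i)] =
  \prod_(i < n) lebesgue_measure (A i).
Proof.
elim: n A => [|n IHn] A mA; first by rewrite big_ord0 /= diracE mem_set//= => -[].
rewrite big_ord_recl -(IHn (fun i => A (lift ord0 i)))//=.
rewrite /lebesgue_step /pushforward.
set B := [set x : Rn R n | forall i, A (lift ord0 i) (tnth x i)].
rewrite (_ : _ @^-1` _ = A ord0 `*` B); last first.
  apply/seteqP; split=> -[a x] /=.
    move=> Aax; split=> [|i]/=; first exact: (Aax ord0).
    by have := Aax (lift ord0 i); rewrite tnthS.
  move=> [Aa Bx] i; have [j ->|->//] := unliftP ord0 i; rewrite tnthS.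
  exact: Bx.
rewrite product_measure1E//.
have -> : B = \bigcap_(i in [set: 'I_n])
    ((@tnth n (measurableTypeR R))^~ i @^-1` A (lift ord0 i)).
  by apply/seteqP; split=> x /= Bx i; [move=> _|]; exact: Bx.
apply: fin_bigcap_measurable => //.
move=> i _; rewrite -[X in measurable X]setTI.
exact: measurable_tnth.
Qed.

End lebesgue_measure_Rn.

Section bounded_oscillation.
Context {R : realType} {d : nat}.
Implicit Types (A B : set (Rn R d)) (f : Rn R d -> R) (g : Rn R d -> \bar R).
Implicit Types (T : (Rn R d -> R) -> Rn R d -> \bar R) (rho alpha : R).

Local Notation mu := (@lebesgue R d).

Definition eucl_dist (x y : Rn R d) : R :=
  Num.sqrt (\sum_(i < d) ((tnth x i : R) - (tnth y i : R)) ^+ 2)%R.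

Definition eucl_ball (c : Rn R d) (r : R) : set (Rn R d) :=
  [set x | (eucl_dist c x < r)%R].

Definition is_eucl_ball B := exists c r, (0 < r)%R /\ B = eucl_ball c r.

(* B^*, for a ball B *)
Definition hull B : set (Rn R d) :=
  \bigcup_(A in [set A | [/\ is_eucl_ball A, mu A <= 2%:E * mu B & A `&` B !=set0]])
    A.

(* <f>_B; B is a ball or the hull of one, so that 0 < mu B < +oo *)
Definition avg rho f B : \bar R :=
  mu B `^ (- rho) * \int[mu]_(x in B) `|f x|%:E.

Definition avg_star rho f B : \bar R :=
  ereal_sup [set avg rho f A | A in [set A | is_eucl_ball A /\ B `<=` A]].

(* The functions inside ess_sup are extended by 0 outside B, resp. B `*` B; as
   they are nonnegative and mu B > 0, this leaves the essential supremum over B,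
   resp. B `*` B, unchanged. *)
Definition SUP B g : \bar R := ess_sup mu ((fun x => `|g x|) \_ B).

Definition OSC B g : \bar R :=
  ess_sup (mu \x mu) ((fun p => `|g p.1 - g p.2|) \_ (B `*` B)).

Definition in_L1 f := mu.-integrable [set: Rn R d] (EFin \o f).

(* T maps L^1 to (almost everywhere finite) measurable functions, and respects
   almost everywhere equality. Values of T f outside of L^1 are irrelevant. *)
Definition L1_operator T :=
  (forall f, in_L1 f -> measurable_fun [set: Rn R d] (T f) /\
     {ae mu, forall x, T f x \is a fin_num}) /\
  (forall f1 f2, in_L1 f1 -> in_L1 f2 -> {ae mu, forall x, f1 x = f2 x} ->
     {ae mu, forall x, T f1 x = T f2 x}).

Definition sublinear T := forall f1 f2, in_L1 f1 -> in_L1 f2 ->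
  {ae mu, forall x, `|T (f1 \+ f2)%R x| <= `|T f1 x| + `|T f2 x|}.

Definition BO_T0 rho T (c0 : R) := forall f, in_L1 f ->
  forall B (lambda : R), is_eucl_ball B -> (0 < lambda)%R ->
  mu [set x | B x /\ lambda%:E * avg rho f B < `|T (f \* \1_B)%R x|] <=
  ((c0 / lambda) `^ rho^-1)%:E * mu B.

Definition BO_T1 rho T (c1 : R) := forall f, in_L1 f -> forall B, is_eucl_ball B ->
  OSC B (T (f \* \1_(~` hull B))%R) <= c1%:E * avg_star rho f B.

Definition BO_T2 rho T (c2 : R) := forall A, is_eucl_ball A ->
  exists B, [/\ is_eucl_ball B, A `<` B & forall f, in_L1 f ->
    SUP A (T (f \* \1_(hull B `\` hull A))%R) <= c2%:E * avg rho f (hull B)].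

(* The parameters r and varrho are both 1. The constants are required to be
   nonnegative because powR is 1 on negative numbers, which would make BO_T0
   void. *)
Definition bounded_oscillation_operator rho T :=
  [/\ L1_operator T, sublinear T &
    exists c0 c1 c2 : R, [/\ 0 <= c0, 0 <= c1 & 0 <= c2]%R /\
      [/\ BO_T0 rho T c0, BO_T1 rho T c1 & BO_T2 rho T c2]].

(* The integrand is 0 instead of infinite at y = x: a null set if 0 < d. *)
Definition riesz_potential alpha f (x : Rn R d) : \bar R :=
  \int[mu]_y (`|f y| / eucl_dist x y `^ (d%:R - alpha))%:E.

Definition fractional_maximal alpha f (x : Rn R d) : \bar R :=
  ereal_sup [set mu B `^ (- (1 - alpha / d%:R)) * \int[mu]_(y in B) `|f y|%:E
            | B in [set B | is_eucl_ball B /\ B x]].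

End bounded_oscillation.

(* Main.v *)
(* Since the measure of a ball of radius [r] is comparable to [r ^ d], the hull
   of that ball lies between two concentric balls of radii comparable to [r], the
   smaller one having radius at least [r + r / (2 d)]. Put [b = d - alpha]. For
   the Riesz potential:
   - (T0) [int_E |x - y|^-b dx <= C |E|^(alpha/d)] for every set [E], by dyadic
     shells around [y]; integrating the potential over the superlevel set [E]
     and exchanging the integrals bounds [|E|];
   - (T1) for [x, x'] in a ball of center [c] and radius [r] and [y] off its hull,
     [|x - y|^-b - |x' - y|^-b <= C |c - y|^-b (r / |c - y|)], which is summed
     over the dyadic shells [2^k r <= |c - y| < 2^(k+1) r];
   - (T2) the kernel is at most [C r^-b] off the hull, and the ball of radius
     [4 d r] is a suitable larger ball.
   The maximal function is pointwise at most a constant times the Riesz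
   potential, and inherits (T0) and (T2). For (T1), a ball that meets both [B] and
   the complement of its hull has a comparable concentric ball containing [B]. *)

From HB Require Import structures.
Require Import Defs.
From mathcomp Require Import all_boot all_order all_algebra.
From mathcomp Require Import all_classical all_reals all_analysis.
From mathcomp Require Import measurable_realfun ess_sup_inf ring lra.

Set Implicit Arguments.
Unset Strict Implicit.
Unset Printing Implicit Defensive.

Import Order.TTheory GRing.Theory Num.Theory.
Import numFieldNormedType.Exports.

Local Open Scope ring_scope.

(** * Balls and hulls *)

Section euclidean_distance.
Local Open Scope classical_set_scope.
Context {R : realType} {d : nat}.
Implicit Types (x y z c : Rn R d) (r s : R).

(** Lagrange's identity: the double sum of the squares [(a i * b j - a j * b i) ^+ 2] is twice the
    difference of the two sides. *)
Lemma cauchy_schwarz (a b : 'I_d -> R) :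
  (\sum_i a i * b i) ^+ 2 <= (\sum_i a i ^+ 2) * (\sum_i b i ^+ 2).
Proof.
have : 0 <= \sum_i \sum_j (a i * b j - a j * b i) ^+ 2.
  by apply: sumr_ge0 => i _; apply: sumr_ge0 => j _; exact: sqr_ge0.
have -> : \sum_i \sum_j (a i * b j - a j * b i) ^+ 2 =
    ((\sum_i a i ^+ 2) * (\sum_i b i ^+ 2)) *+ 2 -
    ((\sum_i a i * b i) ^+ 2) *+ 2.
  transitivity (\sum_i \sum_j (a i ^+ 2 * b j ^+ 2) +
      \sum_i \sum_j (b i ^+ 2 * a j ^+ 2) -
      (\sum_i \sum_j ((a i * b i) * (a j * b j))) *+ 2).
    rewrite -big_split/= -sumrMnl -sumrB; apply: eq_bigr => i _.
    rewrite -big_split/= -sumrMnl -sumrB; apply: eq_bigr => j _.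
    by ring.
  rewrite -!big_distrlr/=; ring.
by rewrite subr_ge0 lerMn2r.
Qed.

Lemma eucl_dist_ge0 x y : 0 <= eucl_dist x y.
Proof. exact: sqrtr_ge0. Qed.

Lemma eucl_distC x y : eucl_dist x y = eucl_dist y x.
Proof.
by rewrite /eucl_dist; congr Num.sqrt; apply: eq_bigr => i _; rewrite -sqrrN opprB.
Qed.

Lemma eucl_dist_triangle y x z :
  eucl_dist x z <= eucl_dist x y + eucl_dist y z.
Proof.
have sge0 u v : 0 <= \sum_(i < d) ((tnth u i : R) - (tnth v i : R)) ^+ 2.
  by apply: sumr_ge0 => i _; exact: sqr_ge0.
rewrite -[leRHS]ger0_norm ?addr_ge0 ?eucl_dist_ge0// -sqrtr_sqr.
apply: ler_wsqrtr; rewrite sqrrD !sqr_sqrtr//.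
pose a (i : 'I_d) : R := (tnth x i : R) - tnth y i.
pose b (i : 'I_d) : R := (tnth y i : R) - tnth z i.
have -> : \sum_(i < d) ((tnth x i : R) - tnth z i) ^+ 2 =
    \sum_i a i ^+ 2 + (\sum_i a i * b i) *+ 2 + \sum_i b i ^+ 2.
  rewrite -sumrMnl -!big_split/=; apply: eq_bigr => i _; rewrite /a /b; ring.
rewrite lerD2r lerD2l lerMn2r/=.
rewrite (le_trans (ler_norm _))// -sqrtr_sqr -sqrtrM//.
by apply: ler_wsqrtr; exact: cauchy_schwarz.
Qed.

Lemma eucl_dist_eq0 x y : eucl_dist x y = 0 -> x = y.
Proof.
move=> /eqP; rewrite sqrtr_eq0 => sle0; apply: eq_from_tnth => i.
have : \sum_(i < d) ((tnth x i : R) - (tnth y i : R)) ^+ 2 == 0.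
  by rewrite eq_le sle0/= sumr_ge0// => j _; exact: sqr_ge0.
rewrite psumr_eq0; last by move=> j _; exact: sqr_ge0.
by move=> /allP/(_ i (mem_index_enum _))/=; rewrite sqrf_eq0 subr_eq0 => /eqP.
Qed.

Lemma eucl_distxx x : eucl_dist x x = 0.
Proof. by rewrite /eucl_dist big1 ?sqrtr0// => i _; rewrite subrr expr0n. Qed.

Lemma tnth_dist_le x y (i : 'I_d) :
  `|(tnth x i : R) - tnth y i| <= eucl_dist x y.
Proof.
rewrite -sqrtr_sqr; apply: ler_wsqrtr; rewrite (bigD1 i)//= lerDl.
by apply: sumr_ge0 => j _; exact: sqr_ge0.
Qed.

(** The sharp factor sqrt(d) is relaxed to [d], using [d <= d ^ 2]; only the order of the constants
    matters later. *)
Lemma eucl_dist_le_sup x y s : 0 <= s ->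
  (forall i, `|(tnth x i : R) - tnth y i| <= s) -> eucl_dist x y <= d%:R * s.
Proof.
move=> s0 xys; rewrite -[leRHS]ger0_norm ?mulr_ge0// -sqrtr_sqr.
apply: ler_wsqrtr; rewrite exprMn.
apply: (@le_trans _ _ (\sum_(i < d) s ^+ 2)).
  by apply: ler_sum => i _; rewrite -real_normK ?num_real// lerXn2r ?nnegrE.
rewrite sumr_const card_ord -(mulr_natl (s ^+ 2) d).
rewrite ler_wpM2r ?sqr_ge0// -natrX ler_nat -[leqLHS]muln1 leq_mul2l.
by case: (d).
Qed.

Lemma eucl_ballP c r : 0 < r -> is_eucl_ball (eucl_ball c r).
Proof. by move=> r0; exists c, r. Qed.

Lemma eucl_ball_sub c r c' r' :
  eucl_dist c' c + r <= r' -> eucl_ball c r `<=` eucl_ball c' r'.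
Proof.
move=> cr x; rewrite /eucl_ball/= => xc; apply: lt_le_trans cr.
by apply: le_lt_trans (eucl_dist_triangle c _ _) _; rewrite ltrD2l.
Qed.

(* A point at distance less than [r + s] from [c] is at distance less than [s]
   from the ball: move towards [c] along the segment. *)
Lemma eucl_ball_meets c r s x : 0 < r -> 0 < s -> eucl_dist c x < r + s ->
  eucl_ball x s `&` eucl_ball c r !=set0.
Proof.
(* The point [p] lies at distance [t * |c - x| < s] from [x] and at distance [(1 - t) * |c - x| < r]
   from [c]. *)
move=> r0 s0 cx; pose t := s / (r + s).
have rs0 : 0 < r + s by lra.
pose p : Rn R d := [tuple (tnth x i : R) + t * ((tnth c i : R) - tnth x i) | i < d].
have t0 : 0 <= t by rewrite divr_ge0// ltW.
have t1 : 0 <= 1 - t by rewrite subr_ge0 ler_pdivrMr// mul1r; lra.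
have scl u v w (k : R) : 0 <= k ->
    (forall i, (tnth u i : R) - tnth v i = k * ((tnth c i : R) - tnth x i)) ->
    w = k * eucl_dist c x -> eucl_dist u v = w.
  move=> k0 uv ->; rewrite -[k in RHS]ger0_norm// -sqrtr_sqr -sqrtrM ?sqr_ge0//.
  rewrite /eucl_dist; congr Num.sqrt; rewrite mulr_sumr.
  by apply: eq_bigr => i _; rewrite uv exprMn.
exists p; rewrite /eucl_ball; split => /=.
  rewrite eucl_distC (@scl _ _ (t * eucl_dist c x) t)//; last first.
    by move=> i; rewrite tnth_mktuple addrC addKr.
  rewrite /t mulrAC ltr_pdivrMr// ltr_pM2l//.
rewrite (@scl _ _ ((1 - t) * eucl_dist c x) (1 - t))//; last first.
  by move=> i; rewrite tnth_mktuple; ring.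
rewrite (_ : 1 - t = r / (r + s)); last by rewrite /t; field; lra.
by rewrite mulrAC ltr_pdivrMr// ltr_pM2l.
Qed.

End euclidean_distance.

(** * Measurability and volume of Euclidean balls *)

Section ball_measure.
Local Open Scope classical_set_scope.
Local Open Scope ereal_scope.
Context {R : realType} {d : nat}.
Implicit Types (x y z c : Rn R d) (r s : R).
Local Notation mu := (@lebesgue R d).

Lemma measurable_eucl_dist2 :
  measurable_fun setT (fun p : Rn R d * Rn R d => eucl_dist p.1 p.2).
Proof.
have H : measurable_fun setT (fun p : Rn R d * Rn R d =>
   (\sum_(i < d) ((tnth p.1 i : R) - (tnth p.2 i : R)) ^+ 2)%R).
  apply: measurable_sum => i; apply: measurable_funX; apply: measurable_funB.
    by apply: (measurableT_comp (measurable_tnth i)); exact: measurable_fst.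
  by apply: (measurableT_comp (measurable_tnth i)); exact: measurable_snd.
rewrite /eucl_dist (_ : (fun p => _) = (fun p : Rn R d * Rn R d =>
   (\sum_(i < d) ((tnth p.1 i : R) - (tnth p.2 i : R)) ^+ 2) `^ 2^-1)%R).
  by apply: (measurableT_comp (measurable_powR _ )); exact: H.
apply/funext => p; rewrite powR12_sqrt//.
by apply: sumr_ge0 => i _; exact: sqr_ge0.
Qed.

Lemma measurable_eucl_dist c : measurable_fun setT (eucl_dist c).
Proof.
exact: (measurableT_comp measurable_eucl_dist2 (measurable_pair1 c)).
Qed.

Lemma measurable_eucl_ball c r : measurable (eucl_ball c r).
Proof.
rewrite (_ : eucl_ball c r = setT `&` eucl_dist c @^-1` [set` `]-oo, r[%R]).
  by apply: measurable_eucl_dist => //; exact: measurable_itv.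
by apply/seteqP; split=> x /=; rewrite /eucl_ball /= in_itv/=; [|case].
Qed.

Lemma lebesgue_cube c (s : R) : (0 < s)%R ->
  mu [set x | forall i, (tnth c i : R) - s <= tnth x i <= (tnth c i : R) + s]%R =
  ((2 * s) ^+ d)%:E.
Proof.
move=> s0.
have -> : [set x : Rn R d |
    forall i, (tnth c i : R) - s <= tnth x i <= (tnth c i : R) + s]%R =
  [set x | forall i,
    ([set` `[(tnth c i : R) - s, (tnth c i : R) + s]%R] : set R) (tnth x i)].
  by apply/seteqP; split => x /= h i; have := h i; rewrite in_itv.
rewrite (@lebesgue_box R d (fun i =>
    ([set` `[(tnth c i : R) - s, (tnth c i : R) + s]%R] : set R))); last first.
  by move=> i; exact: measurable_itv.
rewrite (eq_bigr (fun=> (2 * s)%:E)) => [|i _].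
  by rewrite prodEFin prodr_const card_ord.
rewrite lebesgue_measure_itv/= lte_fin ifT; last by lra.
by rewrite -EFinD; congr EFin; ring.
Qed.

Lemma measurable_cube c (s : R) : measurable
  [set x : Rn R d | forall i, (tnth c i : R) - s <= tnth x i <= (tnth c i : R) + s]%R.
Proof.
rewrite (_ : mkset _ = \bigcap_(i in [set: 'I_d])
    ((@tnth d (measurableTypeR R))^~ i @^-1`
      ([set` `[(tnth c i : R) - s, (tnth c i : R) + s]%R] : set R))).
  apply: fin_bigcap_measurable => // i _; rewrite -[X in measurable X]setTI.
  by apply: measurable_tnth => //; exact: measurable_itv.
apply/seteqP; split => x /= h i; first by move=> _; rewrite /= in_itv/=; exact: h.
by have := h i I; rewrite /= in_itv.
Qed.

(** The ball lies in the concentric cube of side [2 * r]. *)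
Lemma lebesgue_ball_le c r : (0 < r)%R -> mu (eucl_ball c r) <= ((2 * r) ^+ d)%:E.
Proof.
move=> r0; rewrite -(lebesgue_cube c)//; apply: le_measure.
- by rewrite inE; exact: measurable_eucl_ball.
- by rewrite inE; exact: measurable_cube.
- move=> x; rewrite /eucl_ball/= => cx i.
  have := le_lt_trans (tnth_dist_le c x i) cx; rewrite ltr_norml.
  by move=> /andP[]; lra.
Qed.

Lemma lebesgue_ball_ge c r : (0 < r)%R -> (0 < d)%N ->
  ((r / d%:R) ^+ d)%:E <= mu (eucl_ball c r).
Proof.
move=> r0 d0.
have d0' : (0 < d%:R :> R)%R by rewrite ltr0n.
(* The inscribed cube has half-side [r / (2 * d)], so its points are within [r / 2] of [c], strictly
   inside the open ball. *)
have s0 : (0 < r / (2 * d%:R))%R by rewrite divr_gt0// mulr_gt0.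
have -> : (r / d%:R = 2 * (r / (2 * d%:R)))%R by field; rewrite gt_eqF.
rewrite -(lebesgue_cube c)//; apply: le_measure.
- by rewrite inE; exact: measurable_cube.
- by rewrite inE; exact: measurable_eucl_ball.
- move=> x /= h; rewrite /eucl_ball/=.
  apply: (@le_lt_trans _ _ (d%:R * (r / (2 * d%:R)))%R).
    apply: eucl_dist_le_sup; first exact: ltW.
    by move=> i; rewrite ler_norml; have := h i => /andP[]; lra.
  have -> : (d%:R * (r / (2 * d%:R)) = r / 2)%R by field; rewrite gt_eqF.
  lra.
Qed.

Lemma lebesgue_ball_gt0 c r : (0 < r)%R -> (0 < d)%N -> 0 < mu (eucl_ball c r).
Proof.
move=> r0 d0; apply: lt_le_trans (lebesgue_ball_ge c r0 d0).
by rewrite lte_fin exprn_gt0// divr_gt0// ltr0n.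
Qed.

Lemma lebesgue_ball_lty c r : (0 < r)%R -> mu (eucl_ball c r) < +oo.
Proof. by move=> r0; apply: le_lt_trans (lebesgue_ball_le c r0) _; rewrite ltry. Qed.

Lemma lebesgue_set1 c : (0 < d)%N -> mu [set c] = 0.
Proof.
(* In dimension 0 the only point has mass 1; otherwise [[set c]] is a box with a side of length
   0. *)
case: d c => // n c _.
rewrite (_ : [set c] = [set x | forall i, [set (tnth c i : R)] (tnth x i)]).
  rewrite (@lebesgue_box R n.+1 (fun i => [set (tnth c i : R)])); last first.
    by move=> i; exact: measurable_set1.
  by rewrite big_ord_recl lebesgue_measure_set1 mul0e.
apply/seteqP; split => x /=; first by move->.
by move=> h; apply: eq_from_tnth.
Qed.

(* Every point of a ball lies in a rational ball contained in it, so the union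
   is a countable one. *)
Lemma measurable_bigcup_ball (P : set (set (Rn R d))) :
  P `<=` is_eucl_ball -> measurable (\bigcup_(A in P) A).
Proof.
move=> Pball; pose U := \bigcup_(A in P) A.
pose q (k : d.-tuple rat * nat) : set (Rn R d) :=
  eucl_ball [tuple (ratr (tnth k.1 i) : measurableTypeR R) | i < d] k.2.+1%:R^-1.
pose F k := if `[<q k `<=` U>] then q k else set0.
suff -> : \bigcup_(A in P) A = \bigcup_k F k.
  apply: countable_bigcupT_measurable; first exact: countableP.
  move=> k; rewrite /F; case: ifPn => // _; exact: measurable_eucl_ball.
apply/seteqP; split => x; last first.
  by move=> [k _]; rewrite /F; case: asboolP => // qU /qU.
move=> [A PA Ax]; have [c [r [r0 Aeq]]] := Pball _ PA.
move: Ax; rewrite Aeq /eucl_ball/= => cx.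
pose e := (r - eucl_dist c x)%R; have e0 : (0 < e)%R by rewrite subr_gt0.
(* Both [x] and any [y] in the rational ball are within [n.+1%:R^-1] of its centre, hence within [e]
   of each other. *)
have [n ne] : exists n : nat, (n.+1%:R^-1 < e / 2)%R.
  have [n _ /(_ n (leqnn n))] :=
    near_infty_natSinv_lt (PosNum (divr_gt0 e0 (@ltr0Sn R 1%N))).
  by exists n.
(* Dividing by [d.+1] keeps [d%:R * s] strictly below the radius [n.+1%:R^-1]. *)
pose s : R := (n.+1%:R^-1 / (d.+1)%:R)%R.
have s0 : (0 < s)%R by rewrite divr_gt0// ?invr_gt0 ltr0n.
have /choice [v vP] : forall i : 'I_d, exists u : rat,
    (`|ratr u - (tnth x i : R)| < s)%R.
  move=> i; have [|u] := @rat_in_itvoo R ((tnth x i : R) - s)%R ((tnth x i : R) + s)%R.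
    lra.
  by rewrite in_itv/= => /andP[ul ur]; exists u; rewrite ltr_norml; lra.
pose k : d.-tuple rat * nat := ([tuple v i | i < d], n).
have kx : q k x.
  rewrite /q /eucl_ball/=.
  apply: (@le_lt_trans _ _ (d%:R * s)%R).
    apply: eucl_dist_le_sup; first exact: ltW.
    by move=> i; rewrite !tnth_mktuple; exact/ltW/vP.
  by rewrite /s mulrCA gtr_pMr ?invr_gt0// ltr_pdivrMr// mul1r ltr_nat.
exists k => //; rewrite /F asboolT// => y qy; exists A => //.
rewrite Aeq; move: kx qy; rewrite /q /eucl_ball/= => kx ky.
apply: (le_lt_trans (eucl_dist_triangle x _ _)).
set a := mktuple _ in kx ky.
have := eucl_dist_triangle a x y; rewrite (eucl_distC x a).
move: ne; rewrite /e; move: (n.+1%:R^-1)%R kx ky => t kx ky; lra.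
Qed.

End ball_measure.

(** * Negative powers of radii and of measures *)

Section powers.
Local Open Scope ereal_scope.
Context {R : realType}.

Lemma ler_powRN (a b p : R) : (0 < a)%R -> (a <= b)%R -> (0 <= p)%R ->
  (b `^ (- p) <= a `^ (- p))%R.
Proof.
move=> a0 ab p0; have b0 : (0 < b)%R by exact: lt_le_trans ab.
rewrite !powRN lef_pV2 ?posrE ?powR_gt0//.
by apply: ge0_ler_powR => //; rewrite nnegrE ltW.
Qed.

(** Cancels a common length [a], so that the constants in (T1) and (T2) depend only on the ratio [b]
    of two lengths. *)
Lemma powRMN (a b p : R) : (0 < a)%R -> (0 < b)%R ->
  ((a * b) `^ (- p) * a `^ p = b `^ (- p))%R.
Proof.
move=> a0 b0; rewrite powRM ?ltW// mulrAC powRN mulVf ?mul1r//.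
by rewrite gt_eqF// powR_gt0.
Qed.

Lemma powR_expn (a p : R) (n : nat) : (0 <= a)%R ->
  ((a ^+ n) `^ p = a `^ (n%:R * p))%R.
Proof. by move=> a0; rewrite -powR_mulrn// -powRrM. Qed.

(** Finiteness of [m] matters: [+oo] to a negative power is [+oo] here, not 0. *)
Lemma poweRN_le (a rho : R) (m : \bar R) (n : nat) :
  (0 < a)%R -> (0 <= rho)%R -> m < +oo -> (a ^+ n)%:E <= m ->
  m `^ (- rho) <= (a `^ (- (n%:R * rho)))%:E.
Proof.
move=> a0 rho0; case: m => [m| |] // _; rewrite lee_fin => am.
rewrite poweR_EFin lee_fin -mulrN -powR_expn; last exact: ltW.
apply: ler_powRN => //.
exact: exprn_gt0.
Qed.

Lemma poweRN_ge (b rho : R) (m : \bar R) (n : nat) :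
  (0 <= b)%R -> (0 <= rho)%R -> 0 < m -> m <= (b ^+ n)%:E ->
  (b `^ (- (n%:R * rho)))%:E <= m `^ (- rho).
Proof.
move=> b0 rho0; case: m => [m| |] //; rewrite lte_fin lee_fin => m0 am.
by rewrite poweR_EFin lee_fin -mulrN -powR_expn// ler_powRN.
Qed.

(* For the measure [m] of a superlevel set, [m `^ (1 - p)] comes from the
   integral of the kernel over that set; dividing by it solves for [m]. *)
Lemma superlevel_measure_le (lam p c m v : R) : (0 < p)%R -> (0 < lam)%R ->
  (0 <= c)%R -> (0 <= m)%R -> (0 < v)%R ->
  (lam * v `^ (- p) * m <= c * m `^ (1 - p) ->
   m <= (c / lam) `^ p^-1 * v)%R.
Proof.
move=> p0 lam0 c0; rewrite le_eqVlt => /predU1P[<- v0 _|m0 v0 h].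
  by rewrite mulr_ge0 ?powR_ge0 ?ltW.
(* Multiply the hypothesis by [v]^ p[and cancel]m [^ (1 - p)]; the conclusion then follows by taking
   the power [p^-1]. *)
have mv : (m `^ p <= c / lam * v `^ p)%R.
  have e1 : (m `^ (1 - p) * m `^ p = m)%R.
    by rewrite -powRD ?subrK ?powRr1 ?ltW// oner_eq0.
  have h1 : (0 < m `^ (1 - p))%R by exact: powR_gt0.
  have h2 : (0 < v `^ p)%R by exact: powR_gt0.
  rewrite mulrAC ler_pdivlMr//.
  rewrite -(ler_pM2l h1) mulrA e1 mulrA (mulrC _ c).
  have -> : (m * lam = lam * v `^ (- p) * m * v `^ p)%R.
    by rewrite powRN; field; rewrite gt_eqF.
  by rewrite ler_pM2r.
have pV : (0 <= p^-1)%R by rewrite invr_ge0 ltW.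
have powK (u : R) : (0 <= u)%R -> ((u `^ p) `^ p^-1 = u)%R.
  by move=> u0; rewrite -powRrM mulfV ?gt_eqF// powRr1.
have cl0 : (0 <= c / lam)%R by rewrite divr_ge0// ltW.
rewrite -(powK m (ltW m0)) -[X in (_ * X)%R](powK v (ltW v0)).
rewrite -powRM ?powR_ge0//; apply: ge0_ler_powR => //; rewrite nnegrE ?powR_ge0//.
by rewrite mulr_ge0 ?powR_ge0.
Qed.

End powers.

(** * Geometry of hulls, and averages against integrals *)

Section hull.
Local Open Scope classical_set_scope.
Local Open Scope ereal_scope.
Context {R : realType} {d : nat}.
Context (d0 : (0 < d)%N).
Implicit Types (x y z c : Rn R d) (r s rho : R).
Local Notation mu := (@lebesgue R d).

Let d0' : (0 < d%:R :> R)%R. Proof. by rewrite ltr0n. Qed.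

Lemma measurable_hull (B : set (Rn R d)) : measurable (hull B).
Proof. by apply: measurable_bigcup_ball => A []. Qed.

Lemma hull_ball_sub c r : (0 < r)%R ->
  hull (eucl_ball c r) `<=` eucl_ball c ((8 * d%:R + 1) * r)%R.
Proof.
move=> r0 x [A [[a [s [s0 ->]]] ms [p [ap cp]]] ax].
have sr : (s <= 4 * d%:R * r)%R.
  rewrite mulrAC -ler_pdivrMr//.
  have r4 : (0 <= 4 * r)%R by rewrite mulr_ge0// ltW.
  have sd : (0 <= s / d%:R)%R by rewrite divr_ge0// ltW.
  rewrite -(@ler_pXn2r _ d)// -lee_fin; apply: (le_trans (lebesgue_ball_ge a s0 d0)).
  apply: (le_trans ms); have two_ge0 : 0 <= 2%:E :> \bar R by rewrite lee_fin.
  apply: le_trans (lee_wpmul2l two_ge0 (lebesgue_ball_le c r0)) _.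
  rewrite -EFinM lee_fin (_ : 4 * r = 2 * (2 * r))%R; last by ring.
  rewrite [leRHS]exprMn; apply: ler_wpM2r; last by rewrite ler_eXnr// ler1n.
  by rewrite exprn_ge0// mulr_ge0// ltW.
rewrite /eucl_ball/= in ap cp ax *.
have h1 := eucl_dist_triangle p c x; have h2 := eucl_dist_triangle a p x.
by rewrite (eucl_distC p a) in h2; lra.
Qed.

Lemma mem_hull_ball c r y : (0 < r)%R ->
  (eucl_dist c y < r + r / (2 * d%:R))%R -> hull (eucl_ball c r) y.
Proof.
move=> r0 cy; pose s := (r / (2 * d%:R))%R.
have s0 : (0 < s)%R by rewrite divr_gt0// mulr_gt0.
exists (eucl_ball y s); last by rewrite /eucl_ball/= eucl_distxx.
split; [exact: eucl_ballP| |exact: eucl_ball_meets].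
apply: (le_trans (lebesgue_ball_le y s0)).
have -> : (2 * s = r / d%:R)%R by rewrite /s; field; rewrite gt_eqF.
apply: (le_trans (lebesgue_ball_ge c r0 d0)).
by rewrite lee_pemull// lee1n.
Qed.

Lemma ball_sub_hull c r : (0 < r)%R -> eucl_ball c r `<=` hull (eucl_ball c r).
Proof.
move=> r0 x cx; apply: mem_hull_ball => //; apply: lt_trans cx _.
by rewrite ltrDl divr_gt0// mulr_gt0.
Qed.

(** Since [y] is at distance at least [r + r / (2 * d)] from [c], it is at least [r / (2 * d)] away
    from [x]. The last bound follows from [|c - y| <= r + |x - y|]. *)
Lemma notin_hull_ball c r x y : (0 < r)%R -> eucl_ball c r x ->
  ~ hull (eucl_ball c r) y ->
  [/\ r <= eucl_dist c y, r <= 2 * d%:R * eucl_dist x y &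
      eucl_dist c y <= (2 * d%:R + 1) * eucl_dist x y]%R.
Proof.
move=> r0; rewrite /eucl_ball/= => cx hy.
have cy : (r + r / (2 * d%:R) <= eucl_dist c y)%R.
  by rewrite leNgt; apply/negP => /mem_hull_ball-/(_ r0).
have := eucl_dist_triangle x c y.
have rd : (r / (2 * d%:R) * (2 * d%:R) = r)%R.
  by rewrite divfK// gt_eqF// mulr_gt0.
have rd0 : (0 < r / (2 * d%:R))%R by rewrite divr_gt0// mulr_gt0.
move: rd rd0 cy cx; move: (eucl_dist c y) (eucl_dist c x) (eucl_dist x y).
move: (r / (2 * d%:R))%R d0' => e; move: (d%:R)%R => D D0 p q t rd e0 rp qr pqt.
have et : (e <= t)%R by lra.
have DtD : (e * (2 * D) <= t * (2 * D))%R by rewrite ler_wpM2r// mulr_ge0// ltW.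
split; [lra|lra|].
have : (r <= 2 * D * t)%R by lra.
by lra.
Qed.

(** Were [2 * d * s < r], the second ball would have volume at most [(r / d) ^ d]; since it meets
    the first ball, it would be part of the hull. *)
Lemma ball_meets_notin_hull c r a s x y : (0 < r)%R -> (0 < s)%R ->
  eucl_ball c r x -> eucl_ball a s x -> eucl_ball a s y ->
  ~ hull (eucl_ball c r) y -> (r <= 2 * d%:R * s)%R.
Proof.
move=> r0 s0 cx ax ay hy; rewrite leNgt; apply/negP => sr; apply: hy.
exists (eucl_ball a s) => //; split; [exact: eucl_ballP| |by exists x].
apply: (le_trans (lebesgue_ball_le a s0)).
apply: (@le_trans _ _ ((r / d%:R) ^+ d)%:E).
  have sd : (2 * s <= r / d%:R)%R by rewrite ler_pdivlMr// mulrAC ltW.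
  have s2 : (0 <= 2 * s)%R by rewrite mulr_ge0// ltW.
  by rewrite lee_fin lerXn2r// nnegrE// (le_trans s2).
apply: (le_trans (lebesgue_ball_ge c r0 d0)).
by rewrite lee_pemull// lee1n.
Qed.

Lemma lebesgue_hull_gt0 c r : (0 < r)%R -> 0 < mu (hull (eucl_ball c r)).
Proof.
move=> r0; apply: (lt_le_trans (lebesgue_ball_gt0 c r0 d0)).
apply: le_measure; rewrite ?inE; [exact: measurable_eucl_ball|exact: measurable_hull|].
exact: ball_sub_hull.
Qed.

Lemma lebesgue_hull_le c r : (0 < r)%R ->
  mu (hull (eucl_ball c r)) <= ((2 * ((8 * d%:R + 1) * r)) ^+ d)%:E.
Proof.
move=> r0; apply: (@le_trans _ _ (mu (eucl_ball c ((8 * d%:R + 1) * r)%R))).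
  apply: le_measure; rewrite ?inE; [exact: measurable_hull|exact: measurable_eucl_ball|].
  exact: hull_ball_sub.
by apply: lebesgue_ball_le; rewrite mulr_gt0// addr_gt0// mulr_gt0.
Qed.

Section avg.
Context (rho : R).
Context (rho0 : (0 <= rho)%R).
Context (f : Rn R d -> R).

Let int_ge0 (E : set (Rn R d)) : 0 <= \int[mu]_(x in E) `|f x|%:E.
Proof. by apply: integral_ge0 => x _; rewrite lee_fin. Qed.

Lemma avg_ge0 E : 0 <= avg rho f E.
Proof. by rewrite mule_ge0// poweR_ge0. Qed.

(** The bound on [mu E] makes [b]^ (d%:R * rho) * mu E [^ (- rho)] at least 1. *)
Lemma integral_le_avg E b : (0 < b)%R -> 0 < mu E -> mu E <= (b ^+ d)%:E ->
  \int[mu]_(x in E) `|f x|%:E <= (b `^ (d%:R * rho))%:E * avg rho f E.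
Proof.
move=> b0 E0 Eb; rewrite muleA; apply: lee_pemull => //.
have bp := powR_gt0 (d%:R * rho) b0.
have -> : 1 = (b `^ (d%:R * rho))%:E * (b `^ (- (d%:R * rho)))%:E :> \bar R.
  by rewrite -EFinM powRN mulfV// gt_eqF.
apply: lee_wpmul2l; first by rewrite lee_fin ltW.
by apply: poweRN_ge => //; exact: ltW.
Qed.

Lemma avg_ball_le c s : (0 < s)%R ->
  avg rho f (eucl_ball c s) <=
  ((s / d%:R) `^ (- (d%:R * rho)))%:E * \int[mu]_(x in eucl_ball c s) `|f x|%:E.
Proof.
move=> s0; apply: lee_wpmul2r => //; apply: poweRN_le => //.
- by rewrite divr_gt0.
- exact: lebesgue_ball_lty.
- exact: lebesgue_ball_ge.
Qed.

Lemma integral_ball_le c s : (0 < s)%R ->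
  \int[mu]_(x in eucl_ball c s) `|f x|%:E <=
  ((2 * s) `^ (d%:R * rho))%:E * avg rho f (eucl_ball c s).
Proof.
move=> s0; apply: integral_le_avg; [by rewrite mulr_gt0|exact: lebesgue_ball_gt0|].
exact: lebesgue_ball_le.
Qed.

Lemma avg_star_ge0 c r : (0 < r)%R -> 0 <= avg_star rho f (eucl_ball c r).
Proof.
move=> r0; apply: (le_trans (avg_ge0 (eucl_ball c r))); apply: ereal_sup_ubound.
by exists (eucl_ball c r) => //; split => //; exact: eucl_ballP.
Qed.

End avg.
End hull.

(** * The Riesz kernel *)

Section geometric_shells.
Local Open Scope classical_set_scope.
Local Open Scope ereal_scope.
Context d (T : measurableType d) {R : realType}.
Context (mu : {measure set T -> \bar R}).

Lemma nneseries_geometric_le (u : nat -> \bar R) (b q : R) :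
  (0 <= b)%R -> (0 <= q < 1)%R -> (forall k, 0 <= u k <= (b * q ^+ k)%:E) ->
  \sum_(0 <= k <oo) u k <= (b / (1 - q))%:E.
Proof.
move=> b0 /andP[q0 q1] ub; apply: lime_le.
  by apply: is_cvg_nneseries => k _ _; have /andP[] := ub k.
apply: nearW => n; apply: (@le_trans _ _ (\sum_(0 <= k < n) (b * q ^+ k)%:E)).
  by apply: lee_sum => k _; have /andP[] := ub k.
rewrite sumEFin lee_fin.
have /(_ (negbT (lt_eqF q1)))/(congr1 (@^~ n)) := @geometric_seriesE _ b q.
rewrite /series/= => ->; rewrite ler_pM2r ?invr_gt0 ?subr_gt0//.
by rewrite ler_piMr// lerBlDr lerDl exprn_ge0.
Qed.

(** The pieces [F k] may overlap; [seqDU] makes them disjoint without enlarging any of them or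
    changing their union. *)
Lemma integral_shells_le (D : set T) (F : nat -> set T) (g : T -> \bar R)
    (b q : R) :
  (forall k, measurable (F k)) -> measurable D -> D `<=` \bigcup_k F k ->
  measurable_fun setT g -> (forall x, 0 <= g x) ->
  (0 <= b)%R -> (0 <= q < 1)%R ->
  (forall k, \int[mu]_(x in F k) g x <= (b * q ^+ k)%:E) ->
  \int[mu]_(x in D) g x <= (b / (1 - q))%:E.
Proof.
move=> mF mD DF mg g0 b0 q01 Fb.
have mgE (E : set T) : measurable_fun E g by exact: measurable_funTS.
have mU := seqDU_measurable mF.
apply: (@le_trans _ _ (\int[mu]_(x in \bigcup_k seqDU F k) g x)).
  rewrite -seqDU_bigcup_eq; apply: ge0_subset_integral => //.
  exact: bigcup_measurable.
rewrite ge0_integral_bigcup//; apply: nneseries_geometric_le => // k.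
rewrite integral_ge0//=; apply: le_trans (Fb k).
by apply: ge0_subset_integral => //; exact: subset_seqDU.
Qed.

Lemma integral_le_cst (E : set T) (g : T -> \bar R) (a : R) :
  measurable E -> measurable_fun setT g -> (forall x, 0 <= g x) -> (0 <= a)%R ->
  (forall x, E x -> g x <= a%:E) ->
  \int[mu]_(x in E) g x <= a%:E * mu E.
Proof.
move=> mE mg g0 a0 ga; rewrite -integral_cst//.
by apply: ge0_le_integral => //; [exact: measurable_funTS].
Qed.

End geometric_shells.

Section dyadic.
Context {R : realType}.
Implicit Types r s u : R.

Lemma expr2_unbounded u : exists k, u < 2 ^+ k.
Proof.
exists (Num.truncn `|u|).+1; apply: le_lt_trans (ler_norm u) _.
have /andP[_ h] := truncn_itv (normr_ge0 u); apply: (lt_le_trans h).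
by rewrite -natrX ler_nat ltnW// ltn_expl.
Qed.

(** Take the least [k] satisfying the upper bound: minimality gives the lower bound, and for [k = 0]
    it is [r <= u]. The next lemma is the same argument for shells shrinking to 0. *)
Lemma dyadic_above r u : 0 < r -> r <= u ->
  exists k, 2 ^+ k * r <= u < 2 ^+ k.+1 * r.
Proof.
move=> r0 ru.
have ex : exists k, u < 2 ^+ k.+1 * r.
  have [k uk] := expr2_unbounded (u / r); exists k.
  rewrite -ltr_pdivrMr//; apply: lt_le_trans uk _.
  by rewrite ler_eXn2l// ltr1n.
exists (ex_minn ex); case: ex_minnP => -[|k] -> kmin; rewrite andbT.
  by rewrite expr0 mul1r.
by rewrite leNgt; apply/negP => /kmin; rewrite ltnn.
Qed.

Lemma dyadic_below s u : 0 < u -> u < s ->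
  exists k, s / 2 ^+ k.+1 <= u < s / 2 ^+ k.
Proof.
move=> u0 us.
have ex : exists k, s / 2 ^+ k.+1 <= u.
  have [k uk] := expr2_unbounded (s / u); exists k.
  rewrite ler_pdivrMr ?exprn_gt0// mulrC -ler_pdivrMr//; apply: le_trans (ltW uk) _.
  by rewrite ler_eXn2l// ltr1n.
exists (ex_minn ex); case: ex_minnP => -[|k] -> kmin /=.
  by rewrite expr0 divr1.
by rewrite ltNge; apply/negP => /kmin; rewrite ltnn.
Qed.

End dyadic.

(** * Integral bounds for the kernel [|x - y|^-b] *)

Section kernel.
Local Open Scope classical_set_scope.
Local Open Scope ereal_scope.
Context {R : realType} {d : nat}.
Context (b : R).
Context (b0 : (0 < b)%R).
Context (bd : (b < d%:R)%R).
Implicit Types (x y z c : Rn R d) (r s rho : R).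
Local Notation mu := (@lebesgue R d).

(** The exponent stays a parameter: it is [d - alpha] for the potential and 1 for the extra decay in
    (T1). For [b] nonzero the value on the diagonal is 0. *)
Definition riesz_kernel x y : R := (eucl_dist x y `^ (- b))%R.

Lemma riesz_kernel_ge0 x y : (0 <= riesz_kernel x y)%R.
Proof. exact: powR_ge0. Qed.

Lemma riesz_kernelxx x : riesz_kernel x x = 0%R.
Proof. by rewrite /riesz_kernel eucl_distxx powR0// oppr_eq0 gt_eqF. Qed.

Lemma riesz_kernel_le x y s : (0 < s)%R -> (s <= eucl_dist x y)%R ->
  (riesz_kernel x y <= s `^ (- b))%R.
Proof. by move=> s0 sx; apply: ler_powRN => //; exact: ltW. Qed.

Lemma measurable_riesz_kernel2 :
  measurable_fun setT (fun p : Rn R d * Rn R d => riesz_kernel p.1 p.2).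
Proof. exact: (measurableT_comp (measurable_powR _) measurable_eucl_dist2). Qed.

Lemma measurable_riesz_kernel x : measurable_fun setT (riesz_kernel x).
Proof. exact: (measurableT_comp (measurable_powR _) (measurable_eucl_dist x)). Qed.

Lemma measurable_eucl_dist_ge c r : measurable [set x : Rn R d | r <= eucl_dist c x]%R.
Proof.
rewrite (_ : mkset _ = ~` eucl_ball c r).
  by apply: measurableC; exact: measurable_eucl_ball.
by apply/seteqP; split => x; rewrite /eucl_ball/= leNgt => /negP.
Qed.

Lemma measurable_point x : measurable [set x].
Proof.
rewrite (_ : [set x] = setT `&` eucl_dist x @^-1` [set` `]-oo, 0%R]%R]).
  by apply: measurable_eucl_dist => //; exact: measurable_itv.
apply/seteqP; split => y /=; rewrite in_itv/=; first by move=> ->; rewrite eucl_distxx.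
by move=> [_ xy]; apply/esym/eucl_dist_eq0/le_anti; rewrite xy eucl_dist_ge0.
Qed.

Lemma riesz_kernel_ball y s : (0 < s)%R ->
  \int[mu]_(x in eucl_ball y s `\ y) (riesz_kernel y x)%:E <=
  (2 `^ (b + d%:R) * s `^ (d%:R - b) / (1 - 2 `^ (b - d%:R)))%:E.
Proof.
move=> s0.
apply: (@integral_shells_le _ _ _ mu _ (fun k => eucl_ball y (s / 2 ^+ k) `&`
    [set x | (s / 2 ^+ k.+1 <= eucl_dist y x)%R])).
- move=> k; apply: measurableI; first exact: measurable_eucl_ball.
  exact: measurable_eucl_dist_ge.
- by apply: measurableD; [exact: measurable_eucl_ball|exact: measurable_point].
- move=> x []; rewrite /eucl_ball/= => yx xy.
  have [|k /andP[k1 k2]] := dyadic_below _ yx; last by exists k.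
  rewrite lt_neqAle eucl_dist_ge0 andbT eq_sym.
  by apply/eqP => /eucl_dist_eq0 /esym.
- by apply/measurable_EFinP; exact: measurable_riesz_kernel.
- by move=> x; rewrite lee_fin riesz_kernel_ge0.
- by rewrite mulr_ge0// powR_ge0.
- rewrite powR_ge0/= /powR gt_eqF// -[ltRHS]expR0 ltr_expR.
  by rewrite pmulr_llt0 ?subr_lt0// ln_gt0// ltr1n.
move=> k; set t := (s / 2 ^+ k)%R.
have t0 : (0 < t)%R by rewrite divr_gt0// exprn_gt0.
have -> : (s / 2 ^+ k.+1 = t / 2)%R by rewrite exprSr invfM mulrA.
apply: le_trans (@integral_le_cst _ _ _ mu _ _ ((t / 2) `^ (- b)) _ _ _ _ _) _.
- by apply: measurableI; [exact: measurable_eucl_ball|exact: measurable_eucl_dist_ge].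
- by apply/measurable_EFinP; exact: measurable_riesz_kernel.
- by move=> x; rewrite lee_fin riesz_kernel_ge0.
- exact: powR_ge0.
- by move=> x [_ /= tx]; rewrite lee_fin; apply: riesz_kernel_le => //; rewrite divr_gt0.
apply: (@le_trans _ _ (((t / 2) `^ (- b))%:E * ((2 * t) ^+ d)%:E)).
  apply: lee_wpmul2l; first by rewrite lee_fin powR_ge0.
  apply: le_trans (lebesgue_ball_le y t0).
  apply: le_measure; rewrite ?inE; last exact: subIsetl.
    by apply: measurableI; [exact: measurable_eucl_ball|exact: measurable_eucl_dist_ge].
  exact: measurable_eucl_ball.
rewrite -EFinM lee_fin le_eqVlt; apply/orP; left; apply/eqP.
(* The two sides are equal; writing all powers as exponentials reduces this to an identity between
   exponents. *)
have e2 : (expR (ln 2) = 2 :> R)%R by rewrite lnK// posrE.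
have p2 (a : R) : (2 `^ a = expR (a * ln 2))%R by rewrite /powR gt_eqF.
have ps (a u : R) : (0 < u)%R -> (u `^ a = expR (a * ln u))%R.
  by move=> u0; rewrite /powR gt_eqF.
have lt : (ln t = ln s - k%:R * ln 2)%R.
  by rewrite ln_div ?posrE ?exprn_gt0// lnXn// mulr_natl.
rewrite -!powR_mulrn ?powR_ge0 ?mulr_ge0// ?ltW//.
rewrite -powRrM !ps ?divr_gt0 ?mulr_gt0//.
rewrite ln_div ?posrE// lnM ?posrE// lt -!expRD.
by congr expR; ring.
Qed.

Lemma riesz_kernelC x y : riesz_kernel x y = riesz_kernel y x.
Proof. by rewrite /riesz_kernel eucl_distC. Qed.

(** The first summand comes from the ball around the singularity, the summand 1 from the part of the
    set outside that ball. *)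
Definition riesz_kernel_const : R := (2 `^ (b + d%:R) / (1 - 2 `^ (b - d%:R)) + 1)%R.

Lemma riesz_kernel_const_gt0 : (0 < riesz_kernel_const)%R.
Proof.
rewrite ltr_wpDl// divr_ge0 ?powR_ge0// subr_ge0.
rewrite /powR gt_eqF// -[leRHS]expR0 ler_expR.
by rewrite pmulr_lle0 ?ln_gt0 ?ltr1n// subr_le0 ltW.
Qed.

(* Split [E] along the ball of radius [s = mu E `^ d^-1], for which the near and
   far contributions are comparable. *)
Lemma integral_riesz_kernel_le y (E : set (Rn R d)) :
  measurable E -> mu E < +oo ->
  \int[mu]_(x in E) (riesz_kernel x y)%:E <=
  (riesz_kernel_const * fine (mu E) `^ (1 - b / d%:R))%:E.
Proof.
move=> mE Eoo; have d0 : (0 < d%:R :> R)%R by exact: lt_trans bd.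
have mK : measurable_fun setT (fun x => (riesz_kernel y x)%:E).
  by apply/measurable_EFinP; exact: measurable_riesz_kernel.
have K0 x : 0 <= (riesz_kernel y x)%:E by rewrite lee_fin riesz_kernel_ge0.
under eq_integral do rewrite riesz_kernelC.
have Efin : mu E \is a fin_num by rewrite ge0_fin_numE.
have [m0|m0] := eqVneq (mu E) 0.
  rewrite null_set_integral//; last exact: measurable_funTS.
  rewrite lee_fin mulr_ge0 ?powR_ge0//; exact/ltW/riesz_kernel_const_gt0.
set m := fine (mu E).
have mgt0 : (0 < m)%R by rewrite fine_gt0// lt0e m0 measure_ge0 Eoo.
pose s : R := (m `^ d%:R^-1)%R.
have s0 : (0 < s)%R by exact: powR_gt0.
pose D := eucl_ball y s `\ y.
have mD : measurable D.
  by apply: measurableD; [exact: measurable_eucl_ball|exact: measurable_point].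
apply: (@le_trans _ _ (\int[mu]_(x in E `&` D) (riesz_kernel y x)%:E +
    \int[mu]_(x in E `\` D) (riesz_kernel y x)%:E)).
  rewrite -{1}(setUIDK E D) ge0_integral_setU//.
  - exact: measurableI.
  - exact: measurableD.
  - by rewrite setUIDK; exact: measurable_funTS.
  - by rewrite /disj_set; apply/eqP/seteqP; split => // x [[_ Dx] [_ /(_ Dx)]].
rewrite mulrDl mul1r EFinD; apply: leeD.
  apply: (le_trans (@ge0_subset_integral _ _ _ mu _ D _ _ _ _ _ _)) => //.
  - exact: measurableI.
  - exact: measurable_funTS.
  apply: (le_trans (riesz_kernel_ball y s0)).
  rewrite lee_fin mulrAC le_eqVlt; apply/orP; left; apply/eqP; congr (_ * _)%R.
  rewrite /s -powRrM; congr (_ `^ _)%R; rewrite mulrBr mulVf ?gt_eqF//.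
  by rewrite mulrC.
apply: (@le_trans _ _ ((s `^ (- b))%:E * mu (E `\` D))).
  apply: integral_le_cst => //; first exact: measurableD.
    exact: powR_ge0.
  (* The point [y] was removed from [D] and may lie in this part, but the kernel is 0 there. *)
  move=> x [_ Dx]; rewrite lee_fin; have [->|xy] := eqVneq x y.
    by rewrite riesz_kernelxx powR_ge0.
  apply: riesz_kernel_le => //; rewrite leNgt; apply/negP => yx; apply: Dx.
  by split => //; exact/eqP.
apply: (@le_trans _ _ ((s `^ (- b))%:E * mu E)).
  apply: lee_wpmul2l; first by rewrite lee_fin powR_ge0.
  by apply: le_measure; rewrite ?inE//; exact: measurableD.
rewrite -(fineK Efin) -/m -EFinM lee_fin /s -powRrM.
rewrite -{2}[m](powRr1 (ltW mgt0)) -powRD ?(gt_eqF mgt0) ?implybT//.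
by rewrite mulrN mulrC addrC.
Qed.

End kernel.

(** * The Riesz potential and the fractional maximal operator *)

Section oscillation.
Local Open Scope classical_set_scope.
Local Open Scope ereal_scope.
Context {R : realType} {d : nat}.
Implicit Types (B : set (Rn R d)) (g : Rn R d -> \bar R).

Lemma SUP_le B g (M : \bar R) : 0 <= M -> (forall x, B x -> `|g x| <= M) ->
  SUP B g <= M.
Proof.
move=> M0 gM; apply/ess_supP/aeW => x; rewrite patchE.
by case: ifPn => // /set_mem; exact: gM.
Qed.

Lemma OSC_le B g (M : \bar R) : 0 <= M ->
  (forall x x', B x -> B x' -> `|g x - g x'| <= M) -> OSC B g <= M.
Proof.
move=> M0 gM; apply/ess_supP/aeW => -[x x']; rewrite patchE/=.
by case: ifPn => // /set_mem[/= Bx Bx']; exact: gM.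
Qed.

(** Finiteness is essential: [+oo - +oo] is [-oo], of absolute value [+oo]. *)
Lemma abse_sub_le (u v h : \bar R) : u \is a fin_num -> v \is a fin_num ->
  u <= v + h -> v <= u + h -> `|u - v| <= h.
Proof.
move: u v => [u| |] [v| |]// _ _.
case: h => [h| |]; [|by move=> *; exact: leey|by rewrite addeNy].
by rewrite -!EFinD !lee_fin => uv vu; rewrite ler_norml; lra.
Qed.

Lemma abse_ge0_sub_le (u v h : \bar R) : 0 <= u -> 0 <= v -> u <= h -> v <= h ->
  `|u - v| <= h.
Proof.
case: h => [h| |]; last 2 first.
- by move=> *; exact: leey.
- by move=> u0 _ /(le_trans u0).
case: u v => [u| |] [v| |]//; rewrite !lee_fin => u0 v0 uh vh.
by rewrite ler_norml; lra.
Qed.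

End oscillation.

(** * Lipschitz bounds for negative powers *)

Section power_difference.
Context {R : realType}.

(* Bernoulli: with [t = u / w], [t `^ p >= 1 + p * ln t >= 1 - p * (t^-1 - 1)], and
   [t^-1 - 1 = (w - u) / u]. *)
Lemma powRN_sub_le (p u w : R) : 0 <= p -> 0 < u -> u <= w ->
  u `^ (- p) <= w `^ (- p) + p * u `^ (- p) * ((w - u) / u).
Proof.
move=> p0 u0 uw; have w0 : 0 < w by exact: lt_le_trans uw.
have up : 0 < u `^ (- p) by exact: powR_gt0.
have -> : w `^ (- p) = u `^ (- p) * (u / w) `^ p.
  have -> : (u / w) `^ p = u `^ p * w `^ (- p).
    by rewrite powRM ?invr_ge0 ?ltW// -powR_inv1 ?ltW// -powRrM mulN1r.
  by rewrite mulrA (powRN u) mulVf ?mul1r// gt_eqF// powR_gt0.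
have t0 : 0 < u / w by rewrite divr_gt0.
have h1 : 1 + p * ln (u / w) <= (u / w) `^ p.
  by rewrite /powR gt_eqF//; exact: expR_ge1Dx.
have h2 : - ((w - u) / u) <= ln (u / w).
  rewrite -[X in ln X]invf_div lnV ?posrE ?divr_gt0// lerN2.
  have -> : w / u = 1 + (w - u) / u by field; rewrite gt_eqF.
  by apply: le_ln1Dx; rewrite ltr_pdivlMr// mulN1r; lra.
have h3 := ler_wpM2l p0 h2; rewrite mulrN in h3.
have : 1 <= (u / w) `^ p + p * ((w - u) / u) by lra.
rewrite -(ler_pM2l up) mulr1 => /le_trans; apply.
by rewrite le_eqVlt; apply/orP; left; apply/eqP; ring.
Qed.

Lemma powRN_lipschitz (p m u w : R) : 0 <= p -> 0 < m -> m <= u -> m <= w ->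
  u `^ (- p) <= w `^ (- p) + p * m `^ (- p) * (`|u - w| / m).
Proof.
move=> p0 m0 mu mw; have [uw|wu] := leP u w; last first.
  apply: (@le_trans _ _ (w `^ (- p))).
    by apply: ler_powRN => //; [exact: lt_le_trans mw|exact: ltW].
  by rewrite lerDl !mulr_ge0 ?powR_ge0 ?invr_ge0// ltW.
have u0 : 0 < u by exact: lt_le_trans mu.
apply: le_trans (powRN_sub_le p0 u0 uw) _; rewrite lerD2l.
rewrite distrC ger0_norm ?subr_ge0//; apply: ler_pM.
- by rewrite mulr_ge0// powR_ge0.
- by rewrite divr_ge0 ?subr_ge0// ltW.
- by apply: ler_wpM2l => //; exact: ler_powRN.
- by apply: ler_wpM2l; rewrite ?subr_ge0// lef_pV2.
Qed.

End power_difference.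

(** * The Riesz potential *)

Section riesz_and_maximal.
Local Open Scope classical_set_scope.
Local Open Scope ereal_scope.
Context {R : realType} {d : nat}.
Context (alpha : R).
Context (alpha0 : (0 < alpha)%R).
Context (alphad : (alpha < d%:R)%R).
Implicit Types (x y z c : Rn R d) (r s : R) (f g : Rn R d -> R).
Implicit Types (E B : set (Rn R d)).
Local Notation mu := (@lebesgue R d).
Local Notation b := (d%:R - alpha)%R.
Local Notation rho := (1 - alpha / d%:R)%R.
Local Notation K := (riesz_kernel b).

Let b0 : (0 < b)%R. Proof. by rewrite subr_gt0. Qed.
Let bd : (b < d%:R)%R. Proof. by rewrite ltrBlDr ltrDl. Qed.
Let d0R : (0 < d%:R :> R)%R. Proof. exact: lt_trans alphad. Qed.
Let d0 : (0 < d)%N. Proof. by rewrite -(ltr0n R). Qed.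

Lemma riesz_rhoE : (d%:R * rho = b)%R.
Proof. by rewrite mulrBr mulr1 mulrCA mulfV ?mulr1// gt_eqF. Qed.

Lemma riesz_rho_gt0 : (0 < rho)%R.
Proof. by rewrite subr_gt0 ltr_pdivrMr// mul1r. Qed.

Let rho0 : (0 <= rho)%R. Proof. exact/ltW/riesz_rho_gt0. Qed.
Let rhoE : (d%:R * rho)%R = b. Proof. exact: riesz_rhoE. Qed.

Lemma in_L1_measurable f : in_L1 f -> measurable_fun setT f.
Proof. by move=> /measurable_int/measurable_EFinP. Qed.

Lemma measurable_abs_EFin f : measurable_fun setT f ->
  measurable_fun setT (fun x => `|f x|%:E).
Proof. by move=> mf; apply/measurable_EFinP; exact: measurableT_comp. Qed.

Lemma in_L1_restrict f E : measurable E -> in_L1 f -> in_L1 (f \* \1_E)%R.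
Proof.
move=> mE fi; have mf := in_L1_measurable fi.
apply: (le_integrable measurableT _ _ fi).
  by apply/measurable_EFinP; apply: measurable_funM => //; exact: measurable_indic.
move=> x _ /=; rewrite lee_fin normrM ler_piMr// indicE.
by case: (x \in E); rewrite ?normr1 ?normr0.
Qed.

Lemma integral_restrict f E (w : Rn R d -> R) :
  \int[mu]_y (`|(f \* \1_E)%R y| * w y)%:E = \int[mu]_(y in E) (`|f y| * w y)%:E.
Proof.
rewrite [RHS]integral_mkcond; apply: eq_integral => y _.
by rewrite patchE /= indicE; case: (y \in E); rewrite ?mulr1// mulr0 normr0 mul0r.
Qed.

Lemma integral_restrict1 f E :
  \int[mu]_y `|(f \* \1_E)%R y|%:E = \int[mu]_(y in E) `|f y|%:E.
Proof.
rewrite [RHS]integral_mkcond; apply: eq_integral => y _.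
by rewrite patchE /= indicE; case: (y \in E); rewrite ?mulr1// mulr0 normr0.
Qed.

Lemma in_L1_lty f E : measurable E -> in_L1 f -> \int[mu]_(y in E) `|f y|%:E < +oo.
Proof.
move=> mE /integrableP[mf]; apply: le_lt_trans; apply: ge0_subset_integral => //.
by apply: measurable_abs_EFin; exact/measurable_EFinP.
Qed.

Lemma riesz_potentialE f x :
  riesz_potential alpha f x = \int[mu]_y (`|f y| * K x y)%:E.
Proof. by apply: eq_integral => y _; rewrite /riesz_kernel powRN. Qed.

Lemma riesz_potential_ge0 f x : 0 <= riesz_potential alpha f x.
Proof.
rewrite riesz_potentialE; apply: integral_ge0 => y _.
by rewrite lee_fin mulr_ge0// riesz_kernel_ge0.
Qed.

Lemma measurable_riesz_integrand2 f : measurable_fun setT f ->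
  measurable_fun setT (fun p : Rn R d * Rn R d => (`|f p.2| * K p.1 p.2)%:E).
Proof.
move=> mf; apply/measurable_EFinP; apply: measurable_funM.
  apply: measurableT_comp => //; apply: (measurableT_comp mf).
  exact: measurable_snd.
exact: measurable_riesz_kernel2.
Qed.

Lemma measurable_riesz_integrand f x : measurable_fun setT f ->
  measurable_fun setT (fun y => (`|f y| * K x y)%:E).
Proof.
move=> mf; apply/measurable_EFinP; apply: measurable_funM.
  exact: measurableT_comp.
exact: measurable_riesz_kernel.
Qed.

Lemma measurable_riesz_potential f : measurable_fun setT f ->
  measurable_fun setT (riesz_potential alpha f).
Proof.
move=> mf; rewrite (_ : riesz_potential _ _ =
    fubini_F mu (fun p : Rn R d * Rn R d => (`|f p.2| * K p.1 p.2)%:E)).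
  apply: measurable_fun_fubini_tonelli_F; first exact: measurable_riesz_integrand2.
  by move=> p; rewrite lee_fin mulr_ge0// riesz_kernel_ge0.
by apply/funext => x; rewrite riesz_potentialE.
Qed.

Lemma riesz_potential_ae_eq f g x : measurable_fun setT f -> measurable_fun setT g ->
  {ae mu, forall y, f y = g y} -> riesz_potential alpha f x = riesz_potential alpha g x.
Proof.
move=> mf mg fg; rewrite !riesz_potentialE.
apply: ae_eq_integral => //; try exact: measurable_riesz_integrand.
by apply: filterS fg => y /= -> _.
Qed.

Lemma riesz_potential_restrict f E x :
  riesz_potential alpha (f \* \1_E)%R x = \int[mu]_(y in E) (`|f y| * K x y)%:E.
Proof. by rewrite riesz_potentialE integral_restrict. Qed.

Local Notation C := (@riesz_kernel_const R d b).

(** By Tonelli the kernel is integrated over [E] first, with [y] fixed; its bound has the exponent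
    [1 - b / d = alpha / d]. *)
Lemma integral_riesz_potential_le f E : measurable_fun setT f ->
  measurable E -> mu E < +oo ->
  \int[mu]_(x in E) riesz_potential alpha f x <=
  (C * fine (mu E) `^ (alpha / d%:R))%:E * \int[mu]_y `|f y|%:E.
Proof.
move=> mf mE Eoo.
(* The indicator of [E] sits in the integrand so that Tonelli applies on the whole product space. *)
pose F (p : Rn R d * Rn R d) : \bar R := (`|f p.2| * K p.1 p.2 * \1_E p.1)%:E.
have F0 p : 0 <= F p by rewrite lee_fin !mulr_ge0// riesz_kernel_ge0.
have mF : measurable_fun setT F.
  apply/measurable_EFinP; apply: measurable_funM.
    by apply/measurable_EFinP; exact: measurable_riesz_integrand2.
  by apply: (measurableT_comp (measurable_indic mE)); exact: measurable_fst.
have -> : \int[mu]_(x in E) riesz_potential alpha f x = \int[mu]_x \int[mu]_y F (x, y).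
  rewrite integral_mkcond; apply: eq_integral => x _.
  rewrite patchE riesz_potentialE /F/= indicE; case: (x \in E).
    by apply: eq_integral => y _; rewrite mulr1.
  by rewrite integral0_eq// => y _; rewrite mulr0.
rewrite (@fubini_tonelli _ _ _ _ _ mu mu)//.
have c0 : (0 <= C * fine (mu E) `^ (alpha / d%:R))%R.
  by rewrite mulr_ge0 ?powR_ge0//; exact/ltW/riesz_kernel_const_gt0.
rewrite -ge0_integralZl_EFin//; last exact: measurable_abs_EFin.
apply: ge0_le_integral => //.
- by move=> y _; exact: integral_ge0.
- exact: (@measurable_fun_fubini_tonelli_G _ _ _ _ _ mu).
- by apply: measurable_funeM; exact: measurable_abs_EFin.
move=> y _; rewrite /F/=.
have -> : \int[mu]_x (`|f y| * K x y * \1_E x)%:E =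
    `|f y|%:E * \int[mu]_(x in E) (K x y)%:E.
  rewrite [in RHS]integral_mkcond -ge0_integralZl_EFin//.
  - apply: eq_integral => x _; rewrite patchE indicE; case: (x \in E).
      by rewrite mulr1 EFinM.
    by rewrite mulr0 mule0.
  - by move=> x _; apply: erestrict_ge0 => z _; rewrite lee_fin riesz_kernel_ge0.
  - apply/(measurable_restrictT _ mE); apply: measurable_funTS.
    apply/measurable_EFinP; rewrite (_ : (fun x => _) = K y).
      exact: measurable_riesz_kernel.
    by apply/funext => x; rewrite riesz_kernelC.
rewrite muleC; apply: lee_wpmul2r; first by rewrite lee_fin.
apply: le_trans (integral_riesz_kernel_le b0 bd y mE Eoo) _.
by rewrite mulrBl mulfV ?gt_eqF// subKr.
Qed.

(** The potential has a finite integral over each ball about the origin, and the balls of radius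
    [n.+1] exhaust the space. *)
Lemma riesz_potential_ae_fin f : in_L1 f ->
  {ae mu, forall x, riesz_potential alpha f x \is a fin_num}.
Proof.
move=> fi; have mf := in_L1_measurable fi.
pose o : Rn R d := [tuple (0%R : measurableTypeR R) | i < d].
have H n : {ae mu, forall x, eucl_ball o n.+1%:R x ->
    riesz_potential alpha f x \is a fin_num}.
  have mB := measurable_eucl_ball o n.+1%:R.
  have n0 : (0 < n.+1%:R :> R)%R by rewrite ltr0n.
  have mI : measurable_fun (eucl_ball o n.+1%:R) (riesz_potential alpha f).
    by apply: measurable_funTS; exact: measurable_riesz_potential.
  apply: integrable_ae => //; apply/integrableP; split => //.
  under eq_integral do rewrite gee0_abs ?riesz_potential_ge0//.
  apply: le_lt_trans (integral_riesz_potential_le mf mB (lebesgue_ball_lty o n0)) _.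
  apply: lte_mul_pinfty => //; first by rewrite lee_fin mulr_ge0 ?powR_ge0//;
    exact/ltW/riesz_kernel_const_gt0.
  exact: in_L1_lty.
have := ae_foralln H; apply: filterS => x h.
apply: (h (Num.truncn (eucl_dist o x))).
by rewrite /eucl_ball/=; have /andP[] := truncn_itv (eucl_dist_ge0 o x).
Qed.

Lemma riesz_potential_sublinear : sublinear (@riesz_potential R d alpha).
Proof.
move=> f g fi gi; apply: aeW => x.
have mf := in_L1_measurable fi; have mg := in_L1_measurable gi.
rewrite !gee0_abs ?riesz_potential_ge0// !riesz_potentialE.
rewrite -ge0_integralD//; try exact: measurable_riesz_integrand.
- apply: ge0_le_integral => //.
  + by move=> y _; rewrite lee_fin mulr_ge0// riesz_kernel_ge0.
  + by apply: measurable_riesz_integrand; exact: measurable_funD.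
  + by apply: emeasurable_funD; exact: measurable_riesz_integrand.
  + move=> y _; rewrite -EFinD lee_fin -mulrDl ler_wpM2r ?riesz_kernel_ge0//.
    exact: ler_normD.
- by move=> y _; rewrite lee_fin mulr_ge0// riesz_kernel_ge0.
- by move=> y _; rewrite lee_fin mulr_ge0// riesz_kernel_ge0.
Qed.

Lemma riesz_potential_L1_operator : L1_operator (@riesz_potential R d alpha).
Proof.
split=> [f fi|f g fi gi fg]; last first.
  by apply: aeW => x; apply: riesz_potential_ae_eq => //; exact: in_L1_measurable.
split; last exact: riesz_potential_ae_fin.
by apply: measurable_riesz_potential; exact: in_L1_measurable.
Qed.

Lemma riesz_potential_T0 : BO_T0 rho (@riesz_potential R d alpha) C.
Proof.
move=> f fi B lam [c [r [r0 Beq]]] lam0.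
have mB : measurable B by rewrite Beq; exact: measurable_eucl_ball.
have Bgt0 : 0 < mu B by rewrite Beq; exact: lebesgue_ball_gt0.
have Boo : mu B < +oo by rewrite Beq; exact: lebesgue_ball_lty.
have Bfin : mu B \is a fin_num by rewrite ge0_fin_numE.
have fBi := in_L1_restrict mB fi.
have mfB := in_L1_measurable fBi.
have C0 : (0 <= C)%R by exact/ltW/riesz_kernel_const_gt0.
set E := mkset _.
have N0 : 0 <= \int[mu]_(y in B) `|f y|%:E by apply: integral_ge0 => y _; rewrite lee_fin.
have Nfin : \int[mu]_(y in B) `|f y|%:E \is a fin_num.
  by rewrite ge0_fin_numE//; exact: in_L1_lty.
(* The proof later divides by this integral. If it is 0, then [f] vanishes almost everywhere on [B],
   so the potential is identically 0 and [E] is empty. *)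
have [Nz|Nz] := eqVneq (\int[mu]_(y in B) `|f y|%:E) 0.
  suff -> : E = set0.
    by rewrite measure0 mule_ge0// lee_fin powR_ge0.
  apply/seteqP; split => // x [_]; rewrite /avg Nz !mule0.
  rewrite (@riesz_potential_ae_eq _ (cst 0%R))//; last first.
    have /ae_eq_integral_abs : measurable_fun setT (EFin \o (f \* \1_B)%R).
      exact/measurable_EFinP.
    move=> /(_ mu measurableT)/iffLR; rewrite integral_restrict1 => /(_ Nz).
    by apply: filterS => y /(_ I) [].
  rewrite riesz_potentialE integral0_eq ?abse0 ?ltxx//.
  by move=> y _; rewrite /cst normr0 mul0r.
set n := fine (\int[mu]_(y in B) `|f y|%:E).
have n0 : (0 < n)%R by rewrite fine_gt0// lt0e Nz N0/= -ge0_fin_numE.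
set v := fine (mu B).
have v0 : (0 < v)%R by rewrite fine_gt0// Bgt0.
have avgE : lam%:E * avg rho f B = (lam * v `^ (- rho) * n)%:E.
  rewrite /avg -(fineK Nfin) -(fineK Bfin) poweR_EFin -/n -/v.
  by rewrite -!EFinM mulrA.
have mI : measurable_fun setT (riesz_potential alpha (f \* \1_B)%R).
  exact: measurable_riesz_potential.
have mE : measurable E.
  rewrite (_ : E = B `&` [set x | lam%:E * avg rho f B <
      `|riesz_potential alpha (f \* \1_B)%R x|])//.
  apply: emeasurable_fun_o_infty => //; apply: measurable_funTS.
  exact: measurableT_comp.
have EB : mu E <= mu B by apply: le_measure; rewrite ?inE// => x [].
have Eoo : mu E < +oo by exact: le_lt_trans Boo.
have Efin : mu E \is a fin_num by rewrite ge0_fin_numE.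
set t := (lam * v `^ (- rho) * n)%R.
have t0 : (0 <= t)%R by rewrite /t !mulr_ge0 ?powR_ge0 ?ltW.
(* Chebyshev's inequality on [E], combined with the bound for the integral of the potential over
   [E]. *)
have : t%:E * mu E <= (C * fine (mu E) `^ (alpha / d%:R))%:E * n%:E.
  rewrite /n (fineK Nfin) -integral_restrict1.
  apply: le_trans (integral_riesz_potential_le  mfB mE Eoo).
  rewrite -integral_cst//; apply: ge0_le_integral => //.
    exact: measurable_funTS.
  by move=> x [_]; rewrite avgE gee0_abs ?riesz_potential_ge0// => /ltW.
rewrite -(fineK Efin) -(fineK Bfin) -/v -!EFinM !lee_fin => h.
apply: superlevel_measure_le => //; first exact: riesz_rho_gt0.
  by rewrite fine_ge0.
rewrite -(ler_pM2r n0) subKr; apply: le_trans h.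
by rewrite /t mulrAC.
Qed.

Lemma riesz_kernel_le_off_hull c r x y : (0 < r)%R -> eucl_ball c r x ->
  ~ hull (eucl_ball c r) y -> (K x y <= (r / (2 * d%:R)) `^ (- b))%R.
Proof.
move=> r0 cx hy; have [_ h _] := notin_hull_ball d0 r0 cx hy.
apply: riesz_kernel_le => //; first by rewrite divr_gt0// mulr_gt0.
by rewrite ler_pdivrMr ?mulr_gt0// mulrC.
Qed.

(** The base inverts the ratio of two lengths: the side of a cube containing the hull of the larger
    ball, and the least distance [r / (2 * d)] from [A] to a point off its hull. *)
Definition riesz_T2_const : R :=
  ((2 * d%:R * (2 * ((8 * d%:R + 1) * (4 * d%:R))))^-1 `^ (- b))%R.

Lemma riesz_potential_T2 : BO_T2 rho (@riesz_potential R d alpha) riesz_T2_const.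
Proof.
move=> A [c [r [r0 Aeq]]]; pose r' := (4 * d%:R * r)%R.
have d1 : (1 <= d%:R :> R)%R by rewrite ler1n.
have r'0 : (0 < r')%R by rewrite !mulr_gt0.
have rr' : (r <= r')%R by rewrite ler_peMl ?(ltW r0)//; lra.
exists (eucl_ball c r'); split; first exact: eucl_ballP.
  rewrite Aeq; split; first by apply: eucl_ball_sub; rewrite eucl_distxx add0r.
  (* The inclusion is strict by volume: the larger ball has measure at least
     [(r' / d) ^ d = (4 * r) ^ d], while that of [A] is at most [(2 * r) ^ d]. *)
  move=> /(@le_measure _ _ _ mu _ _); rewrite !inE.
  move=> /(_ (measurable_eucl_ball _ _) (measurable_eucl_ball _ _)).
  apply/negP; rewrite -ltNge; apply: (le_lt_trans (lebesgue_ball_le c r0)).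
  apply: (lt_le_trans _ (lebesgue_ball_ge c r'0 d0)).
  rewrite (_ : r' / d%:R = 4 * r)%R; last by rewrite /r'; field; rewrite gt_eqF.
  rewrite lte_fin ltrXn2r//.
  - by rewrite gt_eqF.
  - by rewrite mulr_ge0// ltW.
  - lra.
move=> f fi; set H := hull (eucl_ball c r').
have mH : measurable H by exact: measurable_hull.
have mHA : measurable (H `\` hull A) by apply: measurableD => //; exact: measurable_hull.
have mf := in_L1_measurable fi.
pose L : R := (2 * ((8 * d%:R + 1) * (4 * d%:R)))%R.
have L0 : (0 < L)%R by rewrite !mulr_gt0// addr_gt0// mulr_gt0.
have Lr : (2 * ((8 * d%:R + 1) * r') = L * r)%R by rewrite /L /r'; ring.
have c2ge0 : (0 <= riesz_T2_const)%R by exact: powR_ge0.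
have e0 : (0 < r / (2 * d%:R))%R by rewrite divr_gt0// mulr_gt0.
apply: SUP_le; first by rewrite mule_ge0// avg_ge0.
move=> x Ax; rewrite gee0_abs ?riesz_potential_ge0//.
rewrite Aeq in Ax; rewrite riesz_potential_restrict.
apply: (@le_trans _ _ (\int[mu]_(y in H `\` hull A)
   (((r / (2 * d%:R)) `^ (- b))%:E * `|f y|%:E))).
  apply: ge0_le_integral => //.
  - by move=> y _; rewrite lee_fin mulr_ge0// riesz_kernel_ge0.
  - by apply: measurable_funTS; exact: measurable_riesz_integrand.
  - by apply: measurable_funTS; apply: measurable_funeM; exact: measurable_abs_EFin.
  - move=> y [_]; rewrite Aeq => hy; rewrite -EFinM lee_fin mulrC ler_wpM2r//.
    exact: riesz_kernel_le_off_hull hy.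
rewrite ge0_integralZl_EFin//; last 2 first.
  by apply: measurable_funTS; exact: measurable_abs_EFin.
  exact: powR_ge0.
apply: (@le_trans _ _ (((r / (2 * d%:R)) `^ (- b))%:E * \int[mu]_(y in H) `|f y|%:E)).
  apply: lee_wpmul2l; first by rewrite lee_fin powR_ge0.
  apply: ge0_subset_integral => //.
  by apply: measurable_funTS; exact: measurable_abs_EFin.
apply: (@le_trans _ _ (((r / (2 * d%:R)) `^ (- b))%:E *
    (((L * r) `^ b)%:E * avg rho f H))).
  apply: lee_wpmul2l; first by rewrite lee_fin powR_ge0.
  rewrite -[in (_ `^ b)%R]rhoE; apply: integral_le_avg => //.
  - by rewrite mulr_gt0.
  - exact: lebesgue_hull_gt0.
  - by rewrite -Lr; exact: lebesgue_hull_le.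
rewrite muleA -EFinM.
have -> : (r / (2 * d%:R) = L * r * (2 * d%:R * L)^-1)%R.
  by field; rewrite !gt_eqF.
by rewrite powRMN// ?invr_gt0 ?mulr_gt0.
Qed.

(** The kernel seen from the centre, times the gain [r / |c - y|] that differencing the kernel
    produces. *)
Definition tail_weight c r y : R := (K c y * (r * riesz_kernel 1 c y))%R.

Lemma tail_weight_ge0 c r y : (0 <= r)%R -> (0 <= tail_weight c r y)%R.
Proof. by move=> r0; rewrite !mulr_ge0// riesz_kernel_ge0. Qed.

Lemma measurable_tail f c r : measurable_fun setT f ->
  measurable_fun setT (fun y => (`|f y| * tail_weight c r y)%:E).
Proof.
move=> mf; apply/measurable_EFinP; apply: measurable_funM.
  exact: measurableT_comp.
apply: measurable_funM; first exact: measurable_riesz_kernel.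
by apply: measurable_funM => //; exact: measurable_riesz_kernel.
Qed.

Lemma tail_weight_le c r y (k : nat) : (0 < r)%R ->
  (2 ^+ k * r <= eucl_dist c y)%R ->
  (tail_weight c r y <= (2 ^+ k * r) `^ (- b) * 2^-1 ^+ k)%R.
Proof.
move=> r0 h; have kr0 : (0 < 2 ^+ k * r)%R by rewrite mulr_gt0// exprn_gt0.
apply: ler_pM => //; rewrite ?mulr_ge0 ?riesz_kernel_ge0 ?(ltW r0)//.
  exact: riesz_kernel_le.
apply: (@le_trans _ _ (r * (2 ^+ k * r) `^ (- 1))%R).
  by apply: ler_wpM2l; [exact: ltW|exact: riesz_kernel_le].
rewrite powR_inv1 ?(ltW kr0)// exprVn le_eqVlt; apply/orP; left; apply/eqP.
by field; rewrite !gt_eqF// exprn_gt0.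
Qed.

(** The 4 is the ratio of the side [2 * 2 ^+ k.+1 * r] of a cube around a dyadic shell to its inner
    radius [2 ^+ k * r]; the denominator sums the series of ratio 1/2. *)
Definition tail_const : R := (4^-1 `^ (- b) / (1 - 2^-1))%R.

(** The outer ball of each shell contains the ball of radius [r], so its average is at most
    [avg_star]. The gain in the weight supplies the summable factor [2^-1 ^+ k]. *)
Lemma integral_tail_le f c r : in_L1 f -> (0 < r)%R ->
  \int[mu]_(y in [set y | (r <= eucl_dist c y)%R]) (`|f y| * tail_weight c r y)%:E <=
  tail_const%:E * avg_star rho f (eucl_ball c r).
Proof.
move=> fi r0; have mf := in_L1_measurable fi.
have tc0 : (0 < tail_const)%R.
  by rewrite divr_gt0 ?powR_gt0 ?invr_gt0// subr_gt0 invf_lt1// ltr1n.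
have := avg_star_ge0 rho f c r0.
(* If the supremum is infinite the bound is trivial, as the constant is positive. *)
case E : (avg_star rho f (eucl_ball c r)) => [s| |]//; last first.
  by move=> _; rewrite gt0_muley ?leey.
rewrite lee_fin => s0.
rewrite -EFinM /tail_const mulrAC.
pose F (k : nat) := [set y | (2 ^+ k * r <= eucl_dist c y)%R] `&`
  eucl_ball c (2 ^+ k.+1 * r).
apply: (@integral_shells_le _ _ _ mu _ F).
- move=> k; apply: measurableI; first exact: measurable_eucl_dist_ge.
  exact: measurable_eucl_ball.
- exact: measurable_eucl_dist_ge.
- move=> y /= ry; have [k /andP[k1 k2]] := dyadic_above r0 ry.
  by exists k.
- exact: measurable_tail.
- by move=> y; rewrite lee_fin mulr_ge0// tail_weight_ge0// ltW.
- by rewrite mulr_ge0// powR_ge0.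
- by rewrite invr_ge0 ler0n/= invf_lt1// ltr1n.
move=> k; have kr0 : (0 < 2 ^+ k * r)%R by rewrite mulr_gt0// exprn_gt0.
have k1r0 : (0 < 2 ^+ k.+1 * r)%R by rewrite mulr_gt0// exprn_gt0.
have mFk : measurable (F k).
  by apply: measurableI; [exact: measurable_eucl_dist_ge|exact: measurable_eucl_ball].
have q0 : (0 <= (2 ^+ k * r) `^ (- b) * 2^-1 ^+ k)%R.
  by rewrite mulr_ge0 ?powR_ge0// exprn_ge0// invr_ge0.
apply: (@le_trans _ _ (\int[mu]_(y in F k)
    (((2 ^+ k * r) `^ (- b) * 2^-1 ^+ k)%:E * `|f y|%:E))).
  apply: ge0_le_integral => //.
  - by move=> y _; rewrite lee_fin mulr_ge0// tail_weight_ge0// ltW.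
  - by apply: measurable_funTS; exact: measurable_tail.
  - by apply: measurable_funTS; apply: measurable_funeM; exact: measurable_abs_EFin.
  - move=> y [/= ky _]; rewrite -EFinM lee_fin mulrC ler_wpM2r//.
    exact: tail_weight_le.
rewrite ge0_integralZl_EFin//; last first.
  by apply: measurable_funTS; exact: measurable_abs_EFin.
apply: (@le_trans _ _ (((2 ^+ k * r) `^ (- b) * 2^-1 ^+ k)%:E *
    (((2 * (2 ^+ k.+1 * r)) `^ b)%:E * s%:E))).
  apply: lee_wpmul2l; first by rewrite lee_fin.
  apply: (@le_trans _ _ (\int[mu]_(y in eucl_ball c (2 ^+ k.+1 * r)) `|f y|%:E)).
    apply: ge0_subset_integral => //; first exact: measurable_eucl_ball.
      by apply: measurable_funTS; exact: measurable_abs_EFin.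
    by move=> y [].
  rewrite -[in (_ `^ b)%R]rhoE.
  apply: le_trans (integral_ball_le d0 rho0 f c k1r0) _.
  apply: lee_wpmul2l; first by rewrite lee_fin powR_ge0.
  rewrite -E; apply: ereal_sup_ubound; eexists; last reflexivity.
  split; first exact: eucl_ballP.
  apply: eucl_ball_sub; rewrite eucl_distxx add0r ler_peMl ?(ltW r0)//.
  by rewrite exprn_ege1// ler1n.
rewrite -!EFinM lee_fin.
have -> : (2 ^+ k * r = 2 * (2 ^+ k.+1 * r) * 4^-1)%R by rewrite exprS; field.
have q4 : (0 < 4^-1 :> R)%R by rewrite invr_gt0.
have k2r0 : (0 < 2 * (2 ^+ k.+1 * r))%R by rewrite mulr_gt0.
rewrite -[leRHS]mulrA -(powRMN b k2r0 q4).
by rewrite le_eqVlt; apply/orP; left; apply/eqP; ring.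
Qed.

(** The [b] and the power come from the Lipschitz bound at [m = |c - y| / (2 * d + 1)], the factor
    [2 * (2 * d + 1)] from [2 * r / m]. *)
Definition riesz_T1_const : R :=
  (b * (2 * d%:R + 1)^-1 `^ (- b) * (2 * (2 * d%:R + 1)) * tail_const)%R.

Lemma riesz_T1_const_ge0 : (0 <= riesz_T1_const)%R.
Proof.
rewrite !mulr_ge0 ?powR_ge0 ?(ltW b0)// ?addr_ge0 ?mulr_ge0//.
by rewrite invr_ge0 subr_ge0 invf_le1// ler1n.
Qed.

Lemma riesz_kernel_oscillation c r x x' y : (0 < r)%R ->
  eucl_ball c r x -> eucl_ball c r x' -> ~ hull (eucl_ball c r) y ->
  (K x y <= K x' y +
    b * (2 * d%:R + 1)^-1 `^ (- b) * (2 * (2 * d%:R + 1)) * tail_weight c r y)%R.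
Proof.
move=> r0 cx cx' hy; set D : R := (2 * d%:R + 1)%R.
have D0 : (0 < D)%R by rewrite addr_gt0// mulr_gt0.
have [ry _ xy] := notin_hull_ball d0 r0 cx hy.
have [_ _ xy'] := notin_hull_ball d0 r0 cx' hy.
set del := eucl_dist c y in ry xy xy' *.
have del0 : (0 < del)%R by exact: lt_le_trans ry.
(* A common lower bound for [|x - y|] and [|x' - y|], as the Lipschitz estimate requires. *)
pose m := (del * D^-1)%R.
have m0 : (0 < m)%R by rewrite mulr_gt0// invr_gt0.
have mx : (m <= eucl_dist x y)%R by rewrite ler_pdivrMr// mulrC.
have mx' : (m <= eucl_dist x' y)%R by rewrite ler_pdivrMr// mulrC.
apply: le_trans (powRN_lipschitz (ltW b0) m0 mx mx') _; rewrite lerD2l.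
have xx' : (`|eucl_dist x y - eucl_dist x' y| <= 2 * r)%R.
  have h1 := eucl_dist_triangle x' x y; have h2 := eucl_dist_triangle x x' y.
  have h3 := eucl_dist_triangle c x x'; rewrite (eucl_distC x c) in h3.
  rewrite (eucl_distC x' x) in h2; rewrite /eucl_ball/= in cx cx'.
  by rewrite ler_norml; apply/andP; split; lra.
apply: (@le_trans _ _ (b * m `^ (- b) * (2 * r / m)))%R.
  apply: ler_wpM2l; first by rewrite mulr_ge0 ?powR_ge0 ?(ltW b0).
  by rewrite ler_pM2r// invr_gt0.
rewrite /tail_weight /riesz_kernel -/del powR_inv1 ?(ltW del0)//.
rewrite /m powRM ?(ltW del0) ?invr_ge0 ?(ltW D0)//.
rewrite le_eqVlt; apply/orP; left; apply/eqP; field.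
by rewrite !gt_eqF.
Qed.

Lemma riesz_potential_T1 : BO_T1 rho (@riesz_potential R d alpha) riesz_T1_const.
Proof.
move=> f fi B [c [r [r0 Beq]]]; have mf := in_L1_measurable fi.
have mH : measurable (~` hull B) by apply: measurableC; exact: measurable_hull.
set A1 : R := (b * (2 * d%:R + 1)^-1 `^ (- b) * (2 * (2 * d%:R + 1)))%R.
have A10 : (0 <= A1)%R.
  by rewrite /A1 !mulr_ge0 ?powR_ge0 ?(ltW b0)// addr_ge0// mulr_ge0.
have S0 : 0 <= avg_star rho f B by rewrite Beq; exact: avg_star_ge0.
have tc0 : (0 <= tail_const)%R.
  by rewrite divr_ge0 ?powR_ge0// subr_ge0 invf_le1// ler1n.
set g := (f \* _)%R.
(* Oscillation involves a difference, so finiteness is needed at every point of [B]: off the hull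
   the kernel is bounded and [f] is integrable. *)
have Ifin x : B x -> riesz_potential alpha g x \is a fin_num.
  rewrite Beq => Bx; rewrite ge0_fin_numE ?riesz_potential_ge0//.
  rewrite riesz_potential_restrict.
  apply: (@le_lt_trans _ _ (\int[mu]_(y in ~` hull B)
     (((r / (2 * d%:R)) `^ (- b))%:E * `|f y|%:E))).
    apply: ge0_le_integral => //.
    - by move=> y _; rewrite lee_fin mulr_ge0// riesz_kernel_ge0.
    - by apply: measurable_funTS; exact: measurable_riesz_integrand.
    - by apply: measurable_funTS; apply: measurable_funeM; exact: measurable_abs_EFin.
    - move=> y /=; rewrite Beq => hy; rewrite -EFinM lee_fin mulrC ler_wpM2r//.
      exact: riesz_kernel_le_off_hull hy.
  rewrite ge0_integralZl_EFin//; last 2 first.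
    by apply: measurable_funTS; exact: measurable_abs_EFin.
    exact: powR_ge0.
  by apply: lte_mul_pinfty; rewrite ?lee_fin ?powR_ge0//; exact: in_L1_lty.
have Ile x x' : B x -> B x' -> riesz_potential alpha g x <=
    riesz_potential alpha g x' + riesz_T1_const%:E * avg_star rho f B.
  move=> Bx Bx'; rewrite !riesz_potential_restrict.
  apply: (@le_trans _ _ (\int[mu]_(y in ~` hull B) (`|f y| * K x' y)%:E +
      A1%:E * \int[mu]_(y in ~` hull B) (`|f y| * tail_weight c r y)%:E)).
    have w0 y : 0 <= (`|f y| * tail_weight c r y)%:E.
      by rewrite lee_fin mulr_ge0// tail_weight_ge0// ltW.
    have mw : measurable_fun (~` hull B) (fun y => (`|f y| * tail_weight c r y)%:E).
      by apply: measurable_funTS; exact: measurable_tail.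
    have k0 z y : 0 <= (`|f y| * K z y)%:E.
      by rewrite lee_fin mulr_ge0// riesz_kernel_ge0.
    have mk z : measurable_fun (~` hull B) (fun y => (`|f y| * K z y)%:E).
      by apply: measurable_funTS; exact: measurable_riesz_integrand.
    rewrite -ge0_integralZl_EFin// -ge0_integralD//.
    - apply: ge0_le_integral => //.
      + by apply: emeasurable_funD => //; exact: measurable_funeM.
      + move=> y hy; rewrite -EFinM -EFinD lee_fin mulrCA -mulrDr ler_wpM2l//.
        by rewrite Beq in Bx Bx' hy; exact: riesz_kernel_oscillation.
    - by move=> y _; rewrite mule_ge0.
    - exact: measurable_funeM.
  apply: leeD => //; rewrite /riesz_T1_const -/A1 (EFinM A1) -muleA.
  apply: lee_wpmul2l; first by rewrite lee_fin.
  rewrite Beq; apply: le_trans (integral_tail_le c fi r0).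
  apply: ge0_subset_integral => //; first by rewrite -Beq.
  - exact: measurable_eucl_dist_ge.
  - by apply: measurable_funTS; exact: measurable_tail.
  - by move=> y _; rewrite lee_fin mulr_ge0// tail_weight_ge0// ltW.
  move=> y hy.
  (* Taking the centre as the point of the ball shows that points off the hull satisfy
     [r <= |c - y|]. *)
  have cc : eucl_ball c r c by rewrite /eucl_ball/= eucl_distxx.
  by have [] := notin_hull_ball d0 r0 cc hy.
apply: OSC_le.
  by rewrite mule_ge0// lee_fin mulr_ge0.
move=> x x' Bx Bx'; apply: abse_sub_le; [exact: Ifin|exact: Ifin|exact: Ile|exact: Ile].
Qed.

(** * The fractional maximal operator *)

Local Notation I := (@riesz_potential R d alpha).
Local Notation M := (@fractional_maximal R d alpha).

Lemma avg_le_maximal f B x : is_eucl_ball B -> B x -> avg rho f B <= M f x.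
Proof. by move=> bB Bx; apply: ereal_sup_ubound; exists B. Qed.

Lemma maximal_le f x m :
  (forall B, is_eucl_ball B -> B x -> avg rho f B <= m) -> M f x <= m.
Proof. by move=> h; apply: ge_ereal_sup => _ [B [bB Bx] <-]; exact: h. Qed.

Lemma maximal_ge0 f x : 0 <= M f x.
Proof.
apply: (le_trans (avg_ge0 rho f (eucl_ball x 1))); apply: avg_le_maximal.
  exact: eucl_ballP.
by rewrite /eucl_ball/= eucl_distxx.
Qed.

(** The set where [M f > t] is the union of the balls of average above [t], which is measurable even
    though the family may be uncountable. *)
Lemma measurable_maximal f : measurable_fun setT (M f).
Proof.
apply: (measurability _ (ErealGenOInfty.measurableE R)) => // _ [_ [t ->] <-].
rewrite setTI (_ : _ @^-1` _ =
    \bigcup_(B in [set B | is_eucl_ball B /\ t%:E < avg rho f B]) B).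
  by apply: measurable_bigcup_ball => B [].
apply/seteqP; split => x /=; rewrite in_itv/= andbT.
  by move=> /ereal_sup_gt[_ [B [bB Bx] <-] tB]; exists B.
by move=> [B [bB tB] Bx]; apply: (lt_le_trans tB); exact: avg_le_maximal.
Qed.

(** The base inverts the ratio of [2 * s], bounding the distance of two points in a ball of radius
    [s], to [s / d] from the lower volume bound. *)
Definition maximal_riesz_const : R := ((2 * d%:R)^-1 `^ (- b))%R.

Lemma maximal_riesz_const_gt0 : (0 < maximal_riesz_const)%R.
Proof. by rewrite powR_gt0// invr_gt0 mulr_gt0. Qed.

(* For [x, y] in a ball of radius [s], [|x - y|^-b >= (2 s)^-b]; the point
   [y = x], where the kernel is 0, is a null set. *)
Lemma maximal_le_riesz f x : measurable_fun setT f ->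
  M f x <= maximal_riesz_const%:E * I f x.
Proof.
move=> mf; apply: maximal_le => _ [a [s [s0 ->]]] ax.
apply: le_trans (avg_ball_le d0 rho0 f a s0) _; rewrite rhoE.
have s20 : (0 < 2 * s)%R by rewrite mulr_gt0.
have mB := measurable_eucl_ball a s.
have mBx : measurable (eucl_ball a s `\ x).
  by apply: measurableD => //; exact: measurable_point.
have mA : measurable_fun setT (fun y => `|f y|%:E) by exact: measurable_abs_EFin.
have mK := measurable_riesz_integrand x mf.
have K0 y : 0 <= (`|f y| * K x y)%:E by rewrite lee_fin mulr_ge0// riesz_kernel_ge0.
apply: (@le_trans _ _ (((s / d%:R) `^ (- b))%:E * (((2 * s) `^ b)%:E * I f x))).
  apply: lee_wpmul2l; first by rewrite lee_fin powR_ge0.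
  rewrite (@ge0_negligible_integral _ _ _ mu _ [set x])//; last 3 first.
    exact: measurable_point.
    exact: measurable_funTS.
    exact: lebesgue_set1.
  apply: (@le_trans _ _ (((2 * s) `^ b)%:E *
      \int[mu]_(y in eucl_ball a s `\ x) (`|f y| * K x y)%:E)); last first.
    apply: lee_wpmul2l; first by rewrite lee_fin powR_ge0.
    by rewrite riesz_potentialE; exact: ge0_subset_integral.
  rewrite -ge0_integralZl_EFin ?powR_ge0//; last exact: measurable_funTS.
  apply: ge0_le_integral => //.
  - exact: measurable_funTS.
  - by apply: measurable_funeM; exact: measurable_funTS.
  - move=> y [ay yx]; rewrite -EFinM lee_fin mulrCA ler_peMr//.
    have xy0 : (0 < eucl_dist x y)%R.
      rewrite lt_neqAle eucl_dist_ge0 andbT eq_sym.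
      by apply/eqP => /eucl_dist_eq0/esym.
    have xy : (eucl_dist x y <= 2 * s)%R.
      have := eucl_dist_triangle a x y; rewrite (eucl_distC x a).
      by rewrite /eucl_ball/= in ax ay; lra.
    have h : ((2 * s) `^ (- b) <= K x y)%R by exact: ler_powRN (ltW b0).
    apply: le_trans (ler_wpM2l (powR_ge0 (2 * s) b) h).
    by rewrite powRN mulfV// gt_eqF// powR_gt0.
rewrite muleA -EFinM; apply: lee_wpmul2r; first exact: riesz_potential_ge0.
have q0 : (0 < (2 * d%:R)^-1 :> R)%R by rewrite invr_gt0 mulr_gt0.
rewrite lee_fin /maximal_riesz_const -(powRMN b s20 q0).
have -> : (2 * s * (2 * d%:R)^-1 = s / d%:R)%R by field; rewrite gt_eqF.
by [].
Qed.

Lemma maximal_sublinear : sublinear M.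
Proof.
move=> f g fi gi; apply: aeW => x.
have mf := in_L1_measurable fi; have mg := in_L1_measurable gi.
rewrite !gee0_abs ?maximal_ge0//; apply: maximal_le => B bB Bx.
apply: (@le_trans _ _ (avg rho f B + avg rho g B)); last first.
  by apply: leeD; exact: avg_le_maximal.
have mB : measurable B by have [a [s [_ ->]]] := bB; exact: measurable_eucl_ball.
have N0 (h : Rn R d -> R) : 0 <= \int[mu]_(y in B) `|h y|%:E.
  by apply: integral_ge0 => y _; rewrite lee_fin.
rewrite /avg -ge0_muleDr//.
apply: lee_wpmul2l; first exact: poweR_ge0.
rewrite -ge0_integralD//; try by apply: measurable_funTS; exact: measurable_abs_EFin.
apply: ge0_le_integral => //.
- by apply: measurable_funTS; apply: measurable_abs_EFin; exact: measurable_funD.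
- by apply: emeasurable_funD; apply: measurable_funTS; exact: measurable_abs_EFin.
- by move=> y _; rewrite -EFinD lee_fin ler_normD.
Qed.

Lemma maximal_L1_operator : L1_operator M.
Proof.
split=> [f fi|f g fi gi fg]; last first.
  apply: aeW => x; congr ereal_sup; apply: eq_imagel => B [bB _]; congr (_ * _).
  have mB : measurable B by have [a [s [_ ->]]] := bB; exact: measurable_eucl_ball.
  apply: ae_eq_integral => //.
  - by apply: measurable_funTS; apply: measurable_abs_EFin; exact: in_L1_measurable.
  - by apply: measurable_funTS; apply: measurable_abs_EFin; exact: in_L1_measurable.
  - by apply: filterS fg => y /= -> _.
split; first exact: measurable_maximal.
have := riesz_potential_ae_fin  fi; apply: filterS => x Ix.
rewrite ge0_fin_numE ?maximal_ge0//.
apply: le_lt_trans (maximal_le_riesz x (in_L1_measurable fi)) _.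
apply: lte_mul_pinfty => //; first exact/ltW/maximal_riesz_const_gt0.
by rewrite -ge0_fin_numE// riesz_potential_ge0.
Qed.

Lemma maximal_T0 : BO_T0 rho M (C * maximal_riesz_const).
Proof.
move=> f fi B lam bB lam0; set k := maximal_riesz_const.
have k0 : (0 < k)%R by exact: maximal_riesz_const_gt0.
have mB : measurable B by have [a [s [_ ->]]] := bB; exact: measurable_eucl_ball.
have mfB := in_L1_measurable (in_L1_restrict mB fi).
(* Since [M <= k * I] pointwise, the superlevel set of [M] at [lam] lies in that of [I] at
   [lam / k]. *)
have -> : (C * k / lam = C / (lam / k))%R by rewrite invf_div mulrA.
have lamk0 : (0 < lam / k)%R by rewrite divr_gt0.
apply: le_trans (riesz_potential_T0  fi bB lamk0).
have mlevel (T : Rn R d -> \bar R) (t : \bar R) : measurable_fun setT T ->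
    measurable [set x | B x /\ t < `|T x|].
  move=> mT; apply: emeasurable_fun_o_infty => //; apply: measurable_funTS.
  exact: measurableT_comp.
apply: le_measure; rewrite ?inE.
- by apply: mlevel; exact: measurable_maximal.
- by apply: mlevel; exact: measurable_riesz_potential.
move=> x /= [Bx]; rewrite !gee0_abs ?maximal_ge0 ?riesz_potential_ge0// => tM.
split => //; have := lt_le_trans tM (maximal_le_riesz x mfB).
have -> : lam%:E * avg rho f B = k%:E * ((lam / k)%:E * avg rho f B).
  by rewrite [RHS]muleA -EFinM (mulrC k) divfK// gt_eqF.
by rewrite lte_pmul2l.
Qed.

Lemma maximal_T2 : BO_T2 rho M (maximal_riesz_const * riesz_T2_const).
Proof.
move=> A bA; have [B [bB AB h]] := riesz_potential_T2  bA.
exists B; split => // f fi; set k := maximal_riesz_const.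
have k0 : (0 < k)%R by exact: maximal_riesz_const_gt0.
rewrite EFinM -muleA; apply: le_trans (lee_wpmul2l _ (h f fi)); last exact/ltW.
rewrite /SUP -ess_sup_pZl//; apply: le_ess_sup; apply: aeW => x /=.
rewrite !patchE; case: ifP => _; last by rewrite mule0.
rewrite !gee0_abs ?maximal_ge0 ?riesz_potential_ge0//; apply: maximal_le_riesz.
apply: in_L1_measurable; apply: in_L1_restrict => //.
by apply: measurableD; exact: measurable_hull.
Qed.

(** The base inverts the ratio of [2 * s'] to [s / d], where [s' = (4 * d + 1) * s] is the enlarged
    radius used below. *)
Definition maximal_T1_const : R := ((2 * (4 * d%:R + 1) * d%:R)^-1 `^ (- b))%R.

Lemma maximal_T1 : BO_T1 rho M maximal_T1_const.
Proof.
move=> f fi B bB; have [c [r [r0 Beq]]] := bB.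
have mf := in_L1_measurable fi.
have mH : measurable (~` hull B) by apply: measurableC; exact: measurable_hull.
have S0 : 0 <= avg_star rho f B by rewrite Beq; exact: avg_star_ge0.
have c0 : (0 <= maximal_T1_const)%R by exact: powR_ge0.
have cS0 : 0 <= maximal_T1_const%:E * avg_star rho f B by rewrite mule_ge0.
suff Mle x : B x -> M (f \* \1_(~` hull B))%R x <= maximal_T1_const%:E * avg_star rho f B.
  apply: OSC_le => // x x' Bx Bx'.
  by apply: abse_ge0_sub_le; rewrite ?maximal_ge0//; exact: Mle.
move=> Bx; apply: maximal_le => _ [a [s [s0 ->]]] ax.
have mD := measurable_eucl_ball a s.
(* A ball inside the hull has average 0, since the truncated function vanishes on it. *)
have [Dsub|/existsNP[y /not_implyP[ay hy]]] :=
    pselect (forall y, eucl_ball a s y -> hull B y).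
  rewrite /avg integral0_eq ?mule0// => y ay.
  by rewrite /= indicE memNset ?mulr0 ?normr0//= => /(_ (Dsub _ ay)).
rewrite Beq in Bx hy.
have rs := ball_meets_notin_hull d0 r0 s0 Bx ax ay hy.
(* Here [|a - c| + r < s + 2 * r], and [r <= 2 * d * s], so radius [(4 * d + 1) * s] suffices to
   contain [B]. *)
pose s' : R := ((4 * d%:R + 1) * s)%R.
have s'0 : (0 < s')%R by rewrite mulr_gt0// addr_gt0// mulr_gt0.
have as' : eucl_ball a s `<=` eucl_ball a s'.
  apply: eucl_ball_sub; rewrite eucl_distxx add0r ler_peMl ?(ltW s0)//.
  by rewrite lerDr mulr_ge0.
have Bs' : B `<=` eucl_ball a s'.
  rewrite Beq; apply: eucl_ball_sub.
  have := eucl_dist_triangle x a c; rewrite /eucl_ball/= in Bx ax.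
  by rewrite (eucl_distC x c) /s'; lra.
apply: le_trans (avg_ball_le d0 rho0 _ a s0) _.
apply: (@le_trans _ _ (((s / d%:R) `^ (- (d%:R * rho)))%:E *
    (((2 * s') `^ (d%:R * rho))%:E * avg_star rho f B))).
  apply: lee_wpmul2l; first by rewrite lee_fin powR_ge0.
  apply: (@le_trans _ _ (\int[mu]_(z in eucl_ball a s') `|f z|%:E)).
    apply: (@le_trans _ _ (\int[mu]_(z in eucl_ball a s) `|f z|%:E)).
      apply: ge0_le_integral => //.
      - apply: measurable_funTS; apply: measurable_abs_EFin.
        by apply: in_L1_measurable; exact: in_L1_restrict.
      - by apply: measurable_funTS; exact: measurable_abs_EFin.
      - move=> z _ /=; rewrite lee_fin normrM ler_piMr// indicE.
        by case: (z \in _); rewrite ?normr1 ?normr0.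
    apply: ge0_subset_integral => //; first exact: measurable_eucl_ball.
    by apply: measurable_funTS; exact: measurable_abs_EFin.
  apply: le_trans (integral_ball_le d0 rho0 f a s'0) _.
  apply: lee_wpmul2l; first by rewrite lee_fin powR_ge0.
  apply: ereal_sup_ubound; eexists; last reflexivity.
  by split => //; exact: eucl_ballP.
rewrite muleA -EFinM; apply: lee_wpmul2r => //; rewrite lee_fin rhoE.
have q0 : (0 < (2 * (4 * d%:R + 1) * d%:R)^-1 :> R)%R.
  by rewrite invr_gt0 !mulr_gt0// addr_gt0// mulr_gt0.
have s'20 : (0 < 2 * s')%R by rewrite mulr_gt0.
rewrite /maximal_T1_const -(powRMN b s'20 q0).
have -> : (2 * s' * (2 * (4 * d%:R + 1) * d%:R)^-1 = s / d%:R)%R.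
  have e0 : (0 < 4 * d%:R + 1 :> R)%R by rewrite addr_gt0// mulr_gt0.
  by rewrite /s'; field; rewrite (gt_eqF d0R) (gt_eqF e0).
by [].
Qed.

Lemma riesz_potential_bounded_oscillation :
  bounded_oscillation_operator rho (@riesz_potential R d alpha).
Proof.
split; [exact: riesz_potential_L1_operator|exact: riesz_potential_sublinear|].
exists C, riesz_T1_const, riesz_T2_const; split; split.
- exact/ltW/riesz_kernel_const_gt0.
- exact: riesz_T1_const_ge0.
- exact: powR_ge0.
- exact: riesz_potential_T0.
- exact: riesz_potential_T1.
- exact: riesz_potential_T2.
Qed.

Lemma fractional_maximal_bounded_oscillation :
  bounded_oscillation_operator rho (@fractional_maximal R d alpha).
Proof.
split; [exact: maximal_L1_operator|exact: maximal_sublinear|].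
have k0 := ltW maximal_riesz_const_gt0.
exists (C * maximal_riesz_const)%R, maximal_T1_const,
  (maximal_riesz_const * riesz_T2_const)%R; split; split.
- by rewrite mulr_ge0//; exact/ltW/riesz_kernel_const_gt0.
- exact: powR_ge0.
- by rewrite mulr_ge0// powR_ge0.
- exact: maximal_T0.
- exact: maximal_T1.
- exact: maximal_T2.
Qed.

End riesz_and_maximal.

Theorem theorem9p3 (R : realType) (d : nat) (alpha : R)
    (d_ge1 : (1 <= d)%N) (alpha_gt0 : 0 < alpha) (alpha_ltd : alpha < d%:R) :
  bounded_oscillation_operator (1 - alpha / d%:R)
    (@riesz_potential R d alpha) /\
  bounded_oscillation_operator (1 - alpha / d%:R)
    (@fractional_maximal R d alpha).
Proof.
split; first exact: riesz_potential_bounded_oscillation.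
exact: fractional_maximal_bounded_oscillation.
Qed.
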